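(* Let $k$ be a field of characteristic zero and let $G$ be an affine algebraic supergroup over $k$ with $\mathfrak{g}=\mathrm{Lie}(G)$. There is a linear isomorphism $$\Psi: D(G)\longrightarrow k|G|\otimes\mathcal{U}(\mathfrak{g}),\qquad \phi_g\mapsto g\otimes\phi_e\quad (g\in G(k),\ \phi_g\in D(G,g)),$$ where $\phi_e:=\mathrm{ev}_{g^{-1}}\star\phi_g\in D(G,e)\cong\mathcal{U}(\mathfrak{g})$, which endows $k|G|\otimes\mathcal{U}(\mathfrak{g})$ with a Hopf superalgebra structure. This structure is induced by the natural Hopf structures on the group algebra $k|G|$ and on $\mathcal{U}(\mathfrak{g})$: $$\Delta_{k|G|}(g)=g\otimes g,\qquad \Delta_{\mathcal{U}(\mathfrak{g})}(U)=U\otimes 1+1\otimes U,\qquad g\in G(k),\ U\in\mathfrak{g},$$ and the superalgebra structure is given by $$(g\otimes X)(h\otimes Y)=gh\otimes(h^{-1}X)Y,\qquad g,h\in G(k),\ X,Y\in\mathcal{U}(\mathfrak{g}),$$ where $h^{-1}X:=\mathrm{ev}_{h^{-1}}\star X\star\mathrm{ev}_h$.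
   Context: $G(k)$ is the set of $k$-points (rational points) of $G$, and $\mathcal{O}(G)$ is the commutative Hopf superalgebra of global sections, with comultiplication $\mu^*$ and inverse morphism $i:G\to G$. For $x\in G(k)$ let $m_x\subset\mathcal{O}(G)$ be the maximal ideal of functions vanishing at $x$. $D(G,x)$ (distributions supported at $x$) is the super vector space of linear maps $\phi:\mathcal{O}(G)\to k$ with $m_x^{n+1}\subset\ker\phi$ for some $n$. $D(G)\subset\mathcal{O}(G)^*$ is the super vector space of finite sums $\sum_i\phi_{p_i}$ with $\phi_{p_i}\in D(G,p_i)$, $p_i\in G(k)$. The convolution product is $(\phi\star\psi)(f)=(\phi\otimes\psi)\mu^*(f)$, with unit $\mathrm{ev}_e$, where $\mathrm{ev}_x(f)=f(x)$ and $e$ is the identity of $G$. The Hopf superalgebra structure of $D(G)$ has convolution as product, comultiplication $\Delta(\phi)(f\otimes f')=\phi(ff')$, counit $\phi\mapsto\phi(1)$, and antipode $S(\phi)(f)=\phi(i^*(f))$. $k|G|=\{\sum_{g\in G(k)}\lambda_g g:\lambda_g\in k\}$ (finite sums) is the group algebra of $G(k)$. $\mathcal{U}(\mathfrak{g})$ is the universal enveloping superalgebra; it is identified with the superalgebra $D(G,e)$ via the superalgebra isomorphism extending $\mathfrak{g}=\mathrm{Lie}(G)\cong(m_e/m_e^2)^*\subset D(G,e)$ (characteristic zero). *)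

(* Defs.v *)
From HB Require Import structures.
From mathcomp Require Import all_boot all_algebra.
From mathcomp Require Import boolp functions freeg ring.

Set Implicit Arguments.
Unset Strict Implicit.
Unset Printing Implicit Defensive.

Import GRing.Theory.
Local Open Scope ring_scope.
Local Open Scope quotient_scope.

Section LinearHelpers.
Variables (K : fieldType) (V W : lmodType K) (f : V -> W).
Hypothesis f_lin : linear f.

Lemma linD : {morph f : u v / u + v}.
Proof. by move=> u v; have := f_lin 1 u v; rewrite !scale1r. Qed.

Lemma lin0 : f 0 = 0.
Proof. by apply: (@addrI _ (f 0)); rewrite -linD !addr0. Qed.

Lemma linZ a u : f (a *: u) = a *: f u.
Proof. by have := f_lin a u 0; rewrite !addr0 lin0 addr0. Qed.

Lemma lin_sum (I : Type) (r : seq I) (P : pred I) (F : I -> V) :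
  f (\sum_(i <- r | P i) F i) = \sum_(i <- r | P i) f (F i).
Proof. exact: (big_morph f linD lin0). Qed.

End LinearHelpers.

(* A super vector space: the projections onto the even (false) and the odd    *)
(* (true) summand of V = V_0 ⊕ V_1.                                           *)
HB.mixin Record isSuper (K : fieldType) V of GRing.Lmodule K V := {
  spart : bool -> V -> V;
  spart_linear : forall i, linear (spart i);
  spart_idem : forall i j v, spart i (spart j v) = if i == j then spart j v else 0;
  spart_sum : forall v, spart false v + spart true v = v
}.

#[short(type="superVect")]
HB.structure Definition SuperVect (K : fieldType) :=
  {V of GRing.Lmodule K V & isSuper K V}.

Definition homog (K : fieldType) (V : superVect K) (i : bool) (v : V) : Prop :=
  spart i v = v.

Definition parity_preserving (K : fieldType) (V W : superVect K) (f : V -> W) : Prop :=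
  forall i v, f (spart i v) = spart i (f v).

HB.mixin Record isSuperAlg (K : fieldType) A
    of GRing.Algebra K A & isSuper K A := {
  spart_one : spart false (1 : A) = 1;
  spart_mul : forall i j (a b : A), spart i a = a -> spart j b = b ->
    spart (i (+) j) (a * b) = a * b
}.

#[short(type="superAlg")]
HB.structure Definition SuperAlg (K : fieldType) :=
  {A of GRing.Algebra K A & isSuper K A & isSuperAlg K A}.

Definition superalg_morphism (K : fieldType) (A B : superAlg K) (f : A -> B) : Prop :=
  [/\ linear f, parity_preserving f, f 1 = 1 & {morph f : a b / a * b}].

Notation ksign i j := ((-1) ^+ (i && j)).

Section Tensor.
Variables (K : fieldType) (U V : superVect K).

Definition bilin (W : lmodType K) (b : U -> V -> W) : Prop :=
  (forall v, linear (b ^~ v)) /\ (forall u, linear (b u)).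

(* A finite list of pairs stands for the sum of the corresponding pure        *)
(* tensors; two lists are identified when no bilinear map tells them apart,   *)
(* which is the finest identification making (u, v) |-> [:: (u, v)] bilinear. *)
Definition tens_equiv (s t : seq (U * V)) : bool :=
  `[< forall (W : lmodType K) (b : U -> V -> W), bilin b ->
        \sum_(p <- s) b p.1 p.2 = \sum_(p <- t) b p.1 p.2 >].

Lemma tens_equiv_refl : reflexive tens_equiv.
Proof. by move=> s; apply/asboolP. Qed.

Lemma tens_equiv_sym : symmetric tens_equiv.
Proof.
by move=> s t; apply/asboolP/asboolP => h W b hb; rewrite h.
Qed.

Lemma tens_equiv_trans : transitive tens_equiv.
Proof.
move=> t s r /asboolP h1 /asboolP h2; apply/asboolP => W b hb.
by rewrite h1 // h2.
Qed.

Canonical tens_equiv_rel :=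
  EquivRel tens_equiv tens_equiv_refl tens_equiv_sym tens_equiv_trans.

Definition tens := {eq_quot tens_equiv}.
HB.instance Definition _ := Choice.on tens.

Definition tcls (s : seq (U * V)) : tens := \pi_tens s.

Lemma tcls_eq s t :
  (forall (W : lmodType K) (b : U -> V -> W), bilin b ->
     \sum_(p <- s) b p.1 p.2 = \sum_(p <- t) b p.1 p.2) -> tcls s = tcls t.
Proof. by move=> h; apply/eqmodP/asboolP. Qed.

Definition tpure (u : U) (v : V) : tens := tcls [:: (u, v)].

(* The map U ⊗ V -> W induced by b; meaningful only when b is bilinear. *)
Definition tlift (W : lmodType K) (b : U -> V -> W) (x : tens) : W :=
  \sum_(p <- repr x) b p.1 p.2.

Lemma tlift_cls (W : lmodType K) (b : U -> V -> W) s :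
  bilin b -> tlift b (tcls s) = \sum_(p <- s) b p.1 p.2.
Proof.
move=> hb; rewrite /tlift.
have /eqmodP/asboolP h : repr (tcls s) = s %[mod tens] by rewrite reprK.
exact: h.
Qed.

Lemma tens_eq (x y : tens) :
  (forall (W : lmodType K) (b : U -> V -> W), bilin b -> tlift b x = tlift b y)
  -> x = y.
Proof.
move=> h; rewrite -[x]reprK -[y]reprK; apply: tcls_eq => W b hb.
exact: h.
Qed.

Definition tadd (x y : tens) : tens := tcls (repr x ++ repr y).
Definition tscale (a : K) (x : tens) : tens :=
  tcls [seq (a *: p.1, p.2) | p <- repr x].

Lemma tlift_add (W : lmodType K) (b : U -> V -> W) x y :
  bilin b -> tlift b (tadd x y) = tlift b x + tlift b y.
Proof. by move=> hb; rewrite tlift_cls // big_cat. Qed.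

Lemma tlift_zero (W : lmodType K) (b : U -> V -> W) :
  bilin b -> tlift b (tcls [::]) = 0.
Proof. by move=> hb; rewrite tlift_cls // big_nil. Qed.

Lemma tlift_scale (W : lmodType K) (b : U -> V -> W) a x :
  bilin b -> tlift b (tscale a x) = a *: tlift b x.
Proof.
move=> hb; rewrite tlift_cls // big_map /= scaler_sumr.
by apply: eq_bigr => p _; exact: (linZ (hb.1 _)).
Qed.

Lemma taddA : associative tadd.
Proof. by move=> x y z; apply: tens_eq => W b hb; rewrite !tlift_add ?addrA. Qed.

Lemma taddC : commutative tadd.
Proof. by move=> x y; apply: tens_eq => W b hb; rewrite !tlift_add 1?addrC. Qed.

Lemma tadd0 : left_id (tcls [::]) tadd.
Proof.
by move=> x; apply: tens_eq => W b hb; rewrite tlift_add ?tlift_zero ?add0r.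
Qed.

Lemma taddN : left_inverse (tcls [::]) (tscale (-1)) tadd.
Proof.
move=> x; apply: tens_eq => W b hb.
by rewrite tlift_add ?tlift_zero ?tlift_scale // scaleN1r addNr.
Qed.

HB.instance Definition _ := GRing.isZmodule.Build tens taddA taddC tadd0 taddN.

Lemma tscaleA a c x : tscale a (tscale c x) = tscale (a * c) x.
Proof. by apply: tens_eq => W b hb; rewrite !tlift_scale ?scalerA. Qed.

Lemma tscale1 : left_id 1 tscale.
Proof. by move=> x; apply: tens_eq => W b hb; rewrite tlift_scale ?scale1r. Qed.

Lemma tscaleDr : right_distributive tscale +%R.
Proof.
move=> a x y; apply: tens_eq => W b hb.
by rewrite tlift_scale ?tlift_add ?scalerDr ?tlift_scale.
Qed.

Lemma tscaleDl x : {morph tscale^~ x : a c / a + c}.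
Proof.
move=> a c; apply: tens_eq => W b hb.
by rewrite !(tlift_scale, tlift_add) ?scalerDl.
Qed.

HB.instance Definition _ :=
  GRing.Zmodule_isLmodule.Build K tens tscaleA tscale1 tscaleDr tscaleDl.

Lemma tlift_linear (W : lmodType K) (b : U -> V -> W) :
  bilin b -> linear (tlift b).
Proof. by move=> hb a x y; rewrite tlift_add ?tlift_scale. Qed.

Lemma tliftE (W : lmodType K) (b : U -> V -> W) u v :
  bilin b -> tlift b (tpure u v) = b u v.
Proof. by move=> hb; rewrite tlift_cls // big_seq1. Qed.

Lemma tpure_bilin : bilin tpure.
Proof.
split=> [v a u u'|u a v v']; apply: tens_eq => W b hb;
  rewrite (tlift_linear hb) !tliftE //; [exact: hb.1 | exact: hb.2].
Qed.

Lemma tens_sum (x : tens) : x = \sum_(p <- repr x) tpure p.1 p.2.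
Proof.
apply: tens_eq => W b hb; rewrite (lin_sum (tlift_linear hb)).
by apply: eq_bigr => p _; rewrite tliftE.
Qed.

Lemma tens_ext (W : lmodType K) (f g : tens -> W) : linear f -> linear g ->
  (forall u v, f (tpure u v) = g (tpure u v)) -> f =1 g.
Proof.
move=> hf hg h x; rewrite [x]tens_sum (lin_sum hf) (lin_sum hg).
by apply: eq_bigr.
Qed.

End Tensor.

Notation "u ⊗ v" := (tpure u v) (at level 40, left associativity) : ring_scope.

Section SuperTensor.
Variables (K : fieldType) (U V : superVect K).

Lemma big_bool_add (W : zmodType) (F : bool -> W) :
  \sum_i F i = F false + F true.
Proof. by rewrite big_bool addrC. Qed.

Definition tens_part (c : bool) : tens U V -> tens U V :=
  tlift (fun u v => \sum_(i : bool) spart i u ⊗ spart (i (+) c) v).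

Lemma tens_part_bilin c :
  bilin (fun u v => \sum_(i : bool) spart i u ⊗ spart (i (+) c) v : tens U V).
Proof.
have [h1 h2] := tpure_bilin U V.
split=> [v a u u'|u a v v']; rewrite scaler_sumr -big_split /=;
  apply: eq_bigr => i _; rewrite spart_linear; [exact: h1 | exact: h2].
Qed.

Lemma tens_part_linear c : linear (tens_part c).
Proof. exact: tlift_linear (tens_part_bilin c). Qed.

Lemma tens_part_pure c u v :
  tens_part c (u ⊗ v) = \sum_(i : bool) spart i u ⊗ spart (i (+) c) v.
Proof. exact: tliftE (tens_part_bilin c). Qed.

Lemma tpure0l (v : V) : (0 : U) ⊗ v = 0.
Proof. by rewrite (lin0 ((tpure_bilin U V).1 v)). Qed.

Lemma tpure0r (u : U) : u ⊗ (0 : V) = 0.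
Proof. by rewrite (lin0 ((tpure_bilin U V).2 u)). Qed.

Lemma tens_part_idem c d x :
  tens_part c (tens_part d x) = if c == d then tens_part d x else 0.
Proof.
move: x; apply: tens_ext.
- by move=> a x y; rewrite (tens_part_linear d) (tens_part_linear c).
- case: (c == d) => a x y; first exact: tens_part_linear.
  by rewrite scaler0 addr0.
move=> u v; rewrite tens_part_pure (lin_sum (tens_part_linear c)).
rewrite !big_bool_add !tens_part_pure !big_bool_add.
by case: c; case: d; rewrite !spart_idem /= ?tpure0l ?tpure0r ?addr0 ?add0r.
Qed.

Lemma tens_part_sum x : tens_part false x + tens_part true x = x.
Proof.
move: x; apply: tens_ext => //.
- by move=> a x y; rewrite 2!tens_part_linear scalerDr addrACA.
have [h1 h2] := tpure_bilin U V.
move=> u v; rewrite !tens_part_pure !big_bool_add /= addrACA.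
rewrite -[X in X + _](linD (h2 _)) -[X in _ + X](linD (h2 _)).
rewrite [spart true v + _]addrC spart_sum.
by rewrite -[LHS](linD (h1 v)) spart_sum.
Qed.

HB.instance Definition _ := isSuper.Build K (tens U V)
  tens_part_linear tens_part_idem tens_part_sum.

End SuperTensor.

Section TensorMaps.
Variables (K : fieldType).

(* f ⊗ g for parity-preserving f and g (no sign occurs). *)
Definition tmap (U V U' V' : superVect K) (f : U -> U') (g : V -> V') :
    tens U V -> tens U' V' :=
  tlift (fun u v => f u ⊗ g v).

Definition tassoc (U V W : superVect K) :
    tens (tens U V) W -> tens U (tens V W) :=
  tlift (fun x w => tlift (fun u v => u ⊗ (v ⊗ w)) x).

(* (a ⊗ b)(c ⊗ d) = (-1)^(|b||c|) ac ⊗ bd *)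
Definition tmul (U V : superVect K) (mU : U -> U -> U) (mV : V -> V -> V)
    (x y : tens U V) : tens U V :=
  tlift (fun a b => tlift (fun c d =>
    \sum_(i : bool) \sum_(j : bool)
      ksign i j *: (mU a (spart j c) ⊗ mV (spart i b) d)) y) x.

(* (id ⊗ τ ⊗ id)(ΔU ⊗ ΔV) with τ the super swap *)
Definition tcomul (U V : superVect K) (dU : U -> tens U U) (dV : V -> tens V V) :
    tens U V -> tens (tens U V) (tens U V) :=
  tlift (fun u v =>
    tlift (fun u1 u2 => tlift (fun v1 v2 =>
      \sum_(i : bool) \sum_(j : bool)
        ksign i j *: ((u1 ⊗ spart j v1) ⊗ (spart i u2 ⊗ v2))) (dV v)) (dU u)).

Definition tcounit (U V : superVect K) (eU : U -> K) (eV : V -> K) :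
    tens U V -> K :=
  tlift (fun u v => eU u * eV v : K^o).

End TensorMaps.

Section Multilinear.
Variables (K : fieldType).

Lemma bilin_tpureM (U V U' V' : superVect K) (f : U -> U') (g : V -> V') :
  linear f -> linear g -> bilin (fun u v => f u ⊗ g v).
Proof.
have [h1 h2] := tpure_bilin U' V'.
by move=> hf hg; split=> [v a u u'|u a v v']; rewrite (hf, hg); [exact: h1 | exact: h2].
Qed.

Lemma bilin_mulK (U V : superVect K) (f : U -> K^o) (g : V -> K^o) :
  linear f -> linear g -> bilin (fun u v => f u * g v : K^o).
Proof.
move=> hf hg; split=> [v a u u'|u a v v'].
  by rewrite hf mulrDl -scalerAl.
by rewrite hg mulrDr -scalerAr.
Qed.

Lemma bilin_tlift (U V W : superVect K) (X : lmodType K) (b : W -> U -> V -> X) :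
  (forall w, bilin (b w)) -> (forall u v, linear (fun w => b w u v)) ->
  bilin (fun (x : tens U V) w => tlift (b w) x).
Proof.
move=> h1 h2; split=> [w a x y|x a w w']; first exact: tlift_linear.
by rewrite /tlift scaler_sumr -big_split; apply: eq_bigr => p _; exact: h2.
Qed.

Lemma lin_tlift (U V : superVect K) (W W' : lmodType K) (F : W -> W') (b : U -> V -> W) x :
  linear F -> F (tlift b x) = tlift (fun u v => F (b u v)) x.
Proof. by move=> hF; rewrite /tlift (lin_sum hF). Qed.

Lemma eq_tlift (U V : superVect K) (W : lmodType K) (b b' : U -> V -> W) x :
  (forall u v, b u v = b' u v) -> tlift b x = tlift b' x.
Proof. by move=> h; apply: eq_bigr. Qed.

Section TassocTheory.
Variables (U V W : superVect K).

Lemma bilin_assoc (w : W) : bilin (fun (u : U) (v : V) => u ⊗ (v ⊗ w)).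
Proof.
split=> [v a u u'|u a v v']; first exact: (tpure_bilin _ _).1.
by rewrite (tpure_bilin _ _).1 (tpure_bilin _ _).2.
Qed.

Lemma bilin_tassoc : bilin (fun (x : tens U V) (w : W) =>
  tlift (fun u v => u ⊗ (v ⊗ w)) x).
Proof.
apply: bilin_tlift => [w|u v a w w']; first exact: bilin_assoc.
by rewrite (tpure_bilin _ _).2 (tpure_bilin _ _).2.
Qed.

Lemma tassoc_linear : linear (@tassoc K U V W).
Proof. exact: tlift_linear bilin_tassoc. Qed.

Lemma tassocE (x : tens U V) (w : W) :
  tassoc (x ⊗ w) = tlift (fun u v => u ⊗ (v ⊗ w)) x.
Proof. exact: tliftE bilin_tassoc. Qed.

End TassocTheory.

End Multilinear.

Record hopfOps (K : fieldType) (V : superVect K) := HopfOps {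
  hmul : V -> V -> V;
  hone : V;
  hcomul : V -> tens V V;
  hcounit : V -> K;
  hanti : V -> V
}.

(* All structure maps are parity-preserving, so the Koszul sign shows up only  *)
(* in tmul, the product of the superalgebra V ⊗ V.                            *)
Record is_hopf_superalgebra (K : fieldType) (V : superVect K) (H : hopfOps V)
    : Prop := {
  hopf_mul_bilin : bilin (hmul H);
  hopf_mulA : associative (hmul H);
  hopf_mul1l : left_id (hone H) (hmul H);
  hopf_mul1r : right_id (hone H) (hmul H);
  hopf_mul_part : forall i j u v, homog i u -> homog j v ->
    homog (i (+) j) (hmul H u v);
  hopf_one_even : homog false (hone H);
  hopf_comul_linear : linear (hcomul H);
  hopf_comul_even : parity_preserving (hcomul H);
  hopf_counit_linear : scalar (hcounit H);
  hopf_counit_even : forall v, hcounit H (spart true v) = 0;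
  hopf_coassoc : forall v,
    tassoc (tmap (hcomul H) id (hcomul H v)) = tmap id (hcomul H) (hcomul H v);
  hopf_counitl : forall v, tlift (fun a b => hcounit H a *: b) (hcomul H v) = v;
  hopf_counitr : forall v, tlift (fun a b => hcounit H b *: a) (hcomul H v) = v;
  hopf_comul_mul : forall u v, hcomul H (hmul H u v) =
    tmul (hmul H) (hmul H) (hcomul H u) (hcomul H v);
  hopf_comul_one : hcomul H (hone H) = hone H ⊗ hone H;
  hopf_counit_mul : forall u v, hcounit H (hmul H u v) = hcounit H u * hcounit H v;
  hopf_counit_one : hcounit H (hone H) = 1;
  hopf_anti_linear : linear (hanti H);
  hopf_anti_even : parity_preserving (hanti H);
  hopf_antil : forall v,
    tlift (fun a b => hmul H (hanti H a) b) (hcomul H v) = hcounit H v *: hone H;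
  hopf_antir : forall v,
    tlift (fun a b => hmul H a (hanti H b)) (hcomul H v) = hcounit H v *: hone H
}.

Record hopf_isomorphism (K : fieldType) (V W : superVect K) (H : hopfOps V)
    (H' : hopfOps W) (f : V -> W) : Prop := {
  hopf_iso_linear : linear f;
  hopf_iso_bij : bijective f;
  hopf_iso_even : parity_preserving f;
  hopf_iso_mul : forall u v, f (hmul H u v) = hmul H' (f u) (f v);
  hopf_iso_one : f (hone H) = hone H';
  hopf_iso_comul : forall v, tmap f f (hcomul H v) = hcomul H' (f v);
  hopf_iso_counit : forall v, hcounit H' (f v) = hcounit H v;
  hopf_iso_anti : forall v, f (hanti H v) = hanti H' (f v)
}.

(* An affine algebraic supergroup G, given by its ring of global sections     *)
(* O(G): a finitely generated supercommutative Hopf superalgebra.  The        *)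
(* antipode is the comorphism of i : G -> G, whence the axiom OG_anti that it  *)
(* is a morphism of superalgebras.                                            *)
Record supergroup (K : fieldType) := Supergroup {
  OG :> superAlg K;
  comul : OG -> tens OG OG;
  counit : OG -> K;
  anti : OG -> OG;
  OG_hopf : is_hopf_superalgebra (HopfOps *%R 1 comul counit anti);
  OG_anti : superalg_morphism anti;
  OG_scomm : forall i j (a b : OG), homog i a -> homog j b ->
    a * b = ksign i j *: (b * a);
  OG_fingen : exists s : seq OG, forall P : OG -> Prop,
    P 1 -> (forall a x y, P x -> P y -> P (a *: x + y)) ->
    (forall x y, P x -> P y -> P (x * y)) ->
    (forall x, x \in s -> P x) -> forall x, P x
}.


Section SuperAlgTheory.
Variables (K : fieldType) (A : superAlg K).

Lemma spart_mulE i (a b : A) :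
  spart i (a * b) = \sum_(k : bool) spart k a * spart (k (+) i) b.
Proof.
have E k l : spart i (spart k a * spart l b) =
    if i == k (+) l then spart k a * spart l b else 0.
  by rewrite -(@spart_mul _ _ k l) ?spart_idem ?eqxx.
rewrite -{1}(spart_sum a) -{1}(spart_sum b) mulrDl !mulrDr.
rewrite !(linD (@spart_linear _ _ i)) !E big_bool_add.
by case: i {E} => /=; rewrite ?addr0 ?add0r.
Qed.

Lemma spart_one_odd : spart true (1 : A) = 0.
Proof. by rewrite -(@spart_one _ A) spart_idem. Qed.

Definition idealM (I J : A -> Prop) (f : A) : Prop :=
  exists s : seq (A * A), (forall p, p \in s -> I p.1 /\ J p.2) /\
    f = \sum_(p <- s) p.1 * p.2.

Fixpoint idealX (I : A -> Prop) (n : nat) : A -> Prop :=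
  if n is m.+1 then idealM I (idealX I m) else fun _ => True.

Lemma idealM0 I J : idealM I J 0.
Proof. by exists [::]; rewrite big_nil. Qed.

Lemma idealMD I J f g : idealM I J f -> idealM I J g -> idealM I J (f + g).
Proof.
move=> [s [hs ->]] [t [ht ->]]; exists (s ++ t); rewrite big_cat; split=> // p.
by rewrite mem_cat => /orP [/hs|/ht].
Qed.

Lemma idealM_mul (I J : A -> Prop) a b : I a -> J b -> idealM I J (a * b).
Proof.
by move=> ha hb; exists [:: (a, b)]; rewrite big_seq1; split=> // p /[!inE] /eqP ->.
Qed.

Definition graded (I : A -> Prop) := forall i f, I f -> I (spart i f).

Lemma idealM_graded I J : graded I -> graded J -> graded (idealM I J).
Proof.
move=> hI hJ i f [s [hs ->]]; rewrite (lin_sum (@spart_linear _ _ i)).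
rewrite big_seq; apply: big_ind => [||p /hs [h1 h2]]; first exact: idealM0.
  exact: idealMD.
by rewrite spart_mulE big_bool_add; apply: idealMD; apply: idealM_mul; auto.
Qed.

Lemma idealX_graded I n : graded I -> graded (idealX I n).
Proof. by move=> hI; elim: n => //= n IH; apply: idealM_graded. Qed.

End SuperAlgTheory.

Section Points.
Variables (K : fieldType) (G : supergroup K).

(* G(k): the superalgebra morphisms O(G) -> k, with k purely even *)
Definition is_point (g : G -> K) : Prop :=
  [/\ scalar g, forall f, g (spart true f) = 0, g 1 = 1
    & {morph g : f f' / f * f'}].

Record points := Point {
  pt_fun :> G -> K;
  pt_proof : `[< is_point pt_fun >]
}.
HB.instance Definition _ := [isSub for pt_fun].
HB.instance Definition _ := [Choice of points by <:].

Lemma pointP (g : points) : is_point g.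
Proof. exact/asboolP/(valP g). Qed.

Lemma pt_linear (g : points) : linear (g : G -> K^o).
Proof. by case: (pointP g). Qed.

Lemma pt_even (g : points) f : g (spart false f) = g f.
Proof.
have [_ h _ _] := pointP g.
by rewrite -{2}(spart_sum f) (linD (pt_linear g)) h addr0.
Qed.

Lemma point_ext (g h : points) : g =1 h -> g = h.
Proof. by move=> e; apply: val_inj; apply: funext. Qed.

Let H := OG_hopf G.

Lemma comul_linear : linear (@comul _ G). Proof. exact: hopf_comul_linear H. Qed.

Definition pt_mul_fun (g h : points) (f : G) : K :=
  tlift (fun a b => g a * h b : K^o) (comul f).

Lemma pt_mul_subproof g h : `[< is_point (pt_mul_fun g h) >].
Proof.
have hb := bilin_mulK (pt_linear g) (pt_linear h).
have hl := tlift_linear hb.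
have [_ og1 g1 gM] := pointP g; have [_ oh1 h1 hM] := pointP h.
apply/asboolP; split.
- by move=> a u v; rewrite /pt_mul_fun comul_linear hl.
- move=> f; rewrite /pt_mul_fun.
  have -> : comul (spart true f) = spart true (comul f).
    exact: (hopf_comul_even H).
  rewrite /spart /= /tens_part (lin_tlift _ _ hl); apply: big1 => p _.
  rewrite (lin_sum hl); apply: big1 => i _; rewrite tliftE //.
  by case: i; rewrite /= ?og1 ?oh1 ?mul0r ?mulr0.
- have e : comul (1 : G) = 1 ⊗ 1 by exact: (hopf_comul_one H).
  by rewrite /pt_mul_fun e tliftE // g1 h1 mulr1.
move=> f f'; rewrite /pt_mul_fun.
have -> : comul (f * f') = tmul *%R *%R (comul f) (comul f').
  exact: (hopf_comul_mul H).
rewrite /tmul; rewrite (lin_tlift _ _ hl); rewrite [in RHS]/tlift mulr_suml.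
apply: eq_bigr => p _; rewrite (lin_tlift _ _ hl).
rewrite mulr_sumr; apply: eq_bigr => q _.
rewrite !(linD hl, lin_sum hl) big_bool_add !(lin_sum hl) !big_bool_add.
rewrite !(linZ hl) !tliftE // !gM !hM !pt_even !og1 !oh1.
by rewrite !(mulr0, mul0r, scaler0, addr0) expr0 scale1r mulrACA.
Qed.

Definition pt_mul g h := Point (pt_mul_subproof g h).

Lemma pt_one_subproof : `[< is_point (@counit _ G) >].
Proof.
apply/asboolP; split; [exact: hopf_counit_linear H | exact: hopf_counit_even H
  | exact: hopf_counit_one H | exact: hopf_counit_mul H].
Qed.

Definition pt_one := Point pt_one_subproof.

Lemma pt_inv_subproof (g : points) : `[< is_point (fun f => g (anti f)) >].
Proof.
have [Sl Se S1 SM] := OG_anti G; have [gl og g1 gM] := pointP g.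
apply/asboolP; split.
- by move=> a u v; rewrite Sl gl.
- by move=> f; rewrite Se og.
- by rewrite S1 g1.
by move=> f f'; rewrite SM gM.
Qed.

Definition pt_inv g := Point (pt_inv_subproof g).

Lemma pt_mulA : associative pt_mul.
Proof.
move=> g h l; apply: point_ext => f /=; rewrite /pt_mul_fun /=.
have hl (x y : points) := tlift_linear (bilin_mulK (pt_linear x) (pt_linear y)).
have hb3 := bilin_mulK (pt_linear g) (hl h l).
pose F3 := tlift (fun a y => g a * tlift (fun b c => h b * l c : K^o) y : K^o).
have h3 : linear F3 := tlift_linear hb3.
have F3E a y : F3 (a ⊗ y) = g a * tlift (fun b c => h b * l c : K^o) y := tliftE _ _ hb3.
transitivity (F3 (tmap id (@comul _ G) (comul f))).
  rewrite /tmap (lin_tlift _ _ h3); apply: eq_bigr => p _.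
  by rewrite F3E.
have <- : tassoc (tmap (@comul _ G) id (comul f)) = tmap id (@comul _ G) (comul f).
  exact: (hopf_coassoc H).
rewrite /tmap (lin_tlift _ _ (@tassoc_linear _ _ _ _)) (lin_tlift _ _ h3).
apply: eq_bigr => p _; rewrite tassocE (lin_tlift _ _ h3) /pt_mul_fun.
rewrite [in RHS]/tlift mulr_suml; apply: eq_bigr => q _.
rewrite F3E tliftE ?mulrA //.
exact: (bilin_mulK (pt_linear h) (pt_linear l)).
Qed.

Lemma pt_mul1g : left_id pt_one pt_mul.
Proof.
move=> g; apply: point_ext => f /=; rewrite /pt_mul_fun /=.
have e : tlift (fun a b => counit a *: b) (comul f) = f by exact: (hopf_counitl H).
rewrite -{2}e [RHS](lin_tlift _ _ (pt_linear g)); apply: eq_bigr => p _.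
by rewrite (linZ (pt_linear g)).
Qed.

Lemma pt_mulg1 : right_id pt_one pt_mul.
Proof.
move=> g; apply: point_ext => f /=; rewrite /pt_mul_fun /=.
have e : tlift (fun a b => counit b *: a) (comul f) = f by exact: (hopf_counitr H).
rewrite -{2}e [RHS](lin_tlift _ _ (pt_linear g)); apply: eq_bigr => p _.
by rewrite (linZ (pt_linear g)) mulrC.
Qed.

Lemma pt_mulVg : left_inverse pt_one pt_inv pt_mul.
Proof.
move=> g; apply: point_ext => f /=; rewrite /pt_mul_fun /=.
have [_ _ g1 gM] := pointP g.
have e : tlift (fun a b => anti a * b) (comul f) = counit f *: 1 by exact: (hopf_antil H).
transitivity (g (tlift (fun a b => anti a * b) (comul f))).
  by rewrite [RHS](lin_tlift _ _ (pt_linear g)); apply: eq_bigr => p _; rewrite gM.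
by rewrite e (linZ (pt_linear g)) g1 [LHS]mulr1.
Qed.

Lemma pt_mulgV : right_inverse pt_one pt_inv pt_mul.
Proof.
move=> g; apply: point_ext => f /=; rewrite /pt_mul_fun /=.
have [_ _ g1 gM] := pointP g.
have e : tlift (fun a b => a * anti b) (comul f) = counit f *: 1 by exact: (hopf_antir H).
transitivity (g (tlift (fun a b => a * anti b) (comul f))).
  by rewrite [RHS](lin_tlift _ _ (pt_linear g)); apply: eq_bigr => p _; rewrite gM.
by rewrite e (linZ (pt_linear g)) g1 [LHS]mulr1.
Qed.

HB.instance Definition _ :=
  isGroup.Build points pt_mulA pt_mul1g pt_mulg1 pt_mulVg pt_mulgV.

End Points.

Section Distributions.
Variables (K : fieldType) (G : supergroup K).

Definition pt_ev (x : points G) : G -> K^o := x.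

(* (φ ⊗ ψ)(a ⊗ b) = (-1)^(|ψ||a|) φ(a) ψ(b), the tensor product of linear     *)
(* maps in the category of super vector spaces                                *)
Definition tens_eval (phi psi : G -> K^o) : tens G G -> K^o :=
  tlift (fun a b => \sum_(i : bool) \sum_(j : bool)
    ksign i j * (phi (spart i a) * psi (spart j b)) : K^o).

Definition conv (phi psi : G -> K^o) : G -> K^o :=
  fun f => tens_eval phi psi (comul f).

Definition dual_part (i : bool) (phi : G -> K^o) : G -> K^o :=
  fun f => phi (spart i f).

Definition vanish (x : points G) (f : G) : Prop := x f = 0.

Definition dist_at (x : points G) (phi : G -> K^o) : Prop :=
  linear phi /\ exists n, forall f, idealX (vanish x) n.+1 f -> phi f = 0.

(* D(G) inside O(G)^*: finite sums of functionals supported at single points *)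
Definition is_dist (phi : G -> K^o) : Prop :=
  exists s : seq (points G * (G -> K^o)),
    (forall q, q \in s -> dist_at q.1 q.2) /\ phi = \sum_(q <- s) q.2.

(* Lie(G) = (m_e / m_e^2)^*, a functional on m_e being extended by 0 on the   *)
(* constants                                                                  *)
Definition is_tangent (phi : G -> K^o) : Prop :=
  [/\ linear phi, phi 1 = 0 & forall f, idealX (vanish 1%g) 2 f -> phi f = 0].

Lemma sum_linear (I : eqType) (s : seq I) (F : I -> G -> K^o) :
  (forall i, i \in s -> linear (F i)) -> linear (\sum_(i <- s) F i).
Proof.
move=> h; rewrite big_seq; elim/big_ind: _ => //.
- by move=> a u v /=; rewrite /GRing.zero /= scaler0 addr0.
- move=> f g hf hg a u v; rewrite /GRing.add /= hf hg scalerDr.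
  by rewrite addrACA.
Qed.

Lemma lin_scale a (phi : G -> K^o) : linear phi -> linear (a *: phi).
Proof.
move=> h c u v; have E f : (a *: phi) f = a *: phi f by [].
by rewrite !E h scalerDr !scalerA mulrC.
Qed.

Lemma lin_add (phi psi : G -> K^o) : linear phi -> linear psi -> linear (phi + psi).
Proof. by move=> h h' c u v; rewrite /GRing.add /= h h' scalerDr addrACA. Qed.

Lemma lin_part i (phi : G -> K^o) : linear phi -> linear (dual_part i phi).
Proof. by move=> h a u v; rewrite /dual_part spart_linear h. Qed.

Lemma vanish_graded x : graded (vanish x).
Proof.
move=> [] f; rewrite /vanish; last by rewrite pt_even.
by have [_ -> _ _] := pointP x.
Qed.

Lemma dist_at_scale x a phi : dist_at x phi -> dist_at x (a *: phi).
Proof.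
move=> [h [n hn]]; split; first exact: lin_scale.
by exists n => f /hn; rewrite /GRing.scale /= => ->; rewrite scaler0.
Qed.

Lemma dist_at_part x i phi : dist_at x phi -> dist_at x (dual_part i phi).
Proof.
move=> [h [n hn]]; split; first exact: lin_part.
exists n => f hf; apply: hn.
exact: (idealX_graded (@vanish_graded x)) hf.
Qed.

Definition dist_pred : {pred (G -> K^o)} := fun phi => `[< is_dist phi >].

Lemma dist_closed : submod_closed dist_pred.
Proof.
split; first by apply/asboolP; exists [::]; rewrite big_nil.
move=> a _ _ /asboolP [s [hs ->]] /asboolP [t [ht ->]]; apply/asboolP.
exists ([seq (q.1, a *: q.2) | q <- s] ++ t).
rewrite big_cat big_map scaler_sumr; split=> // q.
rewrite mem_cat => /orP [/mapP [q' /hs h ->]|/ht //].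
exact: dist_at_scale.
Qed.

HB.instance Definition _ :=
  GRing.isSubmodClosed.Build K (G -> K^o) dist_pred
    (GRing.submod_closed_semi dist_closed).

Record dist := Dist {
  dist_fun :> G -> K^o;
  dist_proof : dist_fun \in dist_pred
}.
HB.instance Definition _ := [isSub for dist_fun].
HB.instance Definition _ := [Choice of dist by <:].
HB.instance Definition _ := [SubChoice_isSubLmodule of dist by <:].

Definition tangent_pred : {pred (G -> K^o)} := fun phi => `[< is_tangent phi >].

Record LieG := Tangent {
  tangent_fun :> G -> K^o;
  tangent_proof : tangent_fun \in tangent_pred
}.

Lemma dual_part_linear i : linear (dual_part i).
Proof. by []. Qed.

Lemma dual_part_idem i j phi : linear phi ->
  dual_part i (dual_part j phi) = if i == j then dual_part j phi else 0.
Proof.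
move=> h; apply: funext => f; rewrite /dual_part spart_idem eq_sym.
by case: eqP => [->|_] //; rewrite (lin0 h).
Qed.

Lemma dual_part_sum phi : linear phi ->
  dual_part false phi + dual_part true phi = phi.
Proof.
move=> h; apply: funext => f.
by rewrite -[in RHS](spart_sum f) [RHS](linD h).
Qed.

Lemma dist_linear (phi : dist) : linear phi.
Proof.
case: phi => phi /= /asboolP [s [hs ->]].
by apply: sum_linear => q /hs [].
Qed.

Lemma dist_part_proof i (phi : dist) : dual_part i phi \in dist_pred.
Proof.
case: phi => phi /= /asboolP [s [hs ->]]; apply/asboolP.
exists [seq (q.1, dual_part i q.2) | q <- s]; split.
  by move=> q /mapP [q' /hs h ->]; exact: dist_at_part.
by rewrite big_map (lin_sum (dual_part_linear i)).
Qed.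

Definition dist_part i (phi : dist) : dist := Dist (dist_part_proof i phi).

Lemma dist_part_linear i : linear (dist_part i).
Proof. by move=> a u v; apply: val_inj. Qed.

Lemma dist_part_idem i j phi :
  dist_part i (dist_part j phi) = if i == j then dist_part j phi else 0.
Proof.
apply: val_inj; rewrite /= (dual_part_idem _ _ (@dist_linear phi)).
by case: (i == j).
Qed.

Lemma dist_part_sum phi : dist_part false phi + dist_part true phi = phi.
Proof. by apply: val_inj; rewrite /= (dual_part_sum (@dist_linear phi)). Qed.

HB.instance Definition _ :=
  isSuper.Build K dist dist_part_linear dist_part_idem dist_part_sum.

Lemma tangent_closed : submod_closed tangent_pred.
Proof.
split.
  by apply/asboolP; split=> // a u v; rewrite /GRing.zero /= scaler0 addr0.
move=> a u v /asboolP [ul u1 u2] /asboolP [vl v1 v2]; apply/asboolP.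
have E f : (a *: u + v) f = a *: u f + v f by [].
split.
- by apply: lin_add => //; apply: lin_scale.
- by rewrite E u1 v1 scaler0 addr0.
by move=> f hf; rewrite E u2 ?v2 // scaler0 addr0.
Qed.

HB.instance Definition _ :=
  GRing.isSubmodClosed.Build K (G -> K^o) tangent_pred
    (GRing.submod_closed_semi tangent_closed).
HB.instance Definition _ := [isSub for tangent_fun].
HB.instance Definition _ := [Choice of LieG by <:].
HB.instance Definition _ := [SubChoice_isSubLmodule of LieG by <:].

Lemma tangent_linear (X : LieG) : linear X.
Proof. by case: X => X /= /asboolP []. Qed.

Lemma tangent_part_subproof i phi : is_tangent phi -> is_tangent (dual_part i phi).
Proof.
move=> [h h1 h2]; split; first exact: lin_part.
- rewrite /dual_part; case: i; first by rewrite spart_one_odd (lin0 h).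
  by rewrite (@spart_one _ G).
by move=> f hf; apply: h2; exact: (idealX_graded (@vanish_graded 1%g)) hf.
Qed.

Lemma tangent_part_proof i (X : LieG) : dual_part i X \in tangent_pred.
Proof.
apply/asboolP; apply: tangent_part_subproof.
by case: X => X /= /asboolP.
Qed.

Definition tangent_part i (X : LieG) : LieG := Tangent (tangent_part_proof i X).

Lemma tangent_part_linear i : linear (tangent_part i).
Proof. by move=> a u v; apply: val_inj. Qed.

Lemma tangent_part_idem i j X :
  tangent_part i (tangent_part j X) = if i == j then tangent_part j X else 0.
Proof.
apply: val_inj; rewrite /= (dual_part_idem _ _ (@tangent_linear X)).
by case: (i == j).
Qed.

Lemma tangent_part_sum X : tangent_part false X + tangent_part true X = X.
Proof. by apply: val_inj; rewrite /= (dual_part_sum (@tangent_linear X)). Qed.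

HB.instance Definition _ :=
  isSuper.Build K LieG tangent_part_linear tangent_part_idem tangent_part_sum.

Local Notation e := (1%g : points G).

Definition is_deriv (phi : G -> K^o) : Prop :=
  linear phi /\ forall f f', phi (f * f') = phi f * e f' + e f * phi f'.

Lemma tangentP phi : is_tangent phi <-> is_deriv phi.
Proof.
have [_ _ e1 eM] := pointP e; have eD := linD (pt_linear e).
have eZ := linZ (pt_linear e).
split=> [[h h1 h2]|[h hM]].
  split=> // f f'.
  pose a := f - e f *: 1; pose a' := f' - e f' *: 1.
  have va u : vanish e (u - e u *: 1).
    by rewrite /vanish eD -scaleNr eZ e1 /= /GRing.scale /= mulr1 subrr.
  have : phi (a * a') = 0.
    apply: h2; apply: idealM_mul; first exact: va.
    by rewrite -[a']mulr1; apply: idealM_mul; first exact: va.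
  have -> : a * a' = f * f' - e f' *: f - e f *: a'.
    rewrite /a mulrBl -scalerAl mul1r /a' mulrBr -scalerAr mulr1.
    by rewrite scalerBr.
  have hN u : phi (- u) = - phi u by rewrite -scaleN1r (linZ h) scaleN1r.
  rewrite !(linD h) !hN !(linZ h) /a' (linD h) hN (linZ h) h1 scaler0 subr0.
  move/eqP; rewrite -addrA -opprD subr_eq0 => /eqP ->.
  by rewrite mulrC.
have h1 : phi 1 = 0.
  have := hM 1 1; rewrite mulr1 e1 mulr1 mul1r => /eqP.
  by rewrite -subr_eq0 opprD addNKr oppr_eq0 => /eqP.
split=> // f [s [hs ->]]; rewrite (lin_sum h) big_seq; apply: big1 => p /hs.
rewrite /vanish => -[p1 [t [ht p2]]].
rewrite hM p1 mul0r addr0 p2 (lin_sum (pt_linear e)) big1_seq ?mulr0 //.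
by move=> q /andP [_ /ht [q1 _]]; rewrite eM q1 mul0r.
Qed.

Definition hom_dual (s : bool) (phi : G -> K^o) : Prop :=
  forall i f, phi (spart i f) = if i == s then phi f else 0.

Lemma hom_dual_part s phi : linear phi -> hom_dual s (dual_part s phi).
Proof.
by move=> h i f; rewrite /dual_part spart_idem eq_sym; case: eqP => [->|_]; rewrite ?(lin0 h).
Qed.

Lemma hom_dual_pt (x : points G) : hom_dual false (pt_ev x).
Proof.
by have [_ o _ _] := pointP x; case=> f; rewrite /pt_ev ?o ?pt_even.
Qed.

Let P (phi psi : G -> K^o) : tens G G -> K^o :=
  tlift (fun a b => phi a * psi b : K^o).

Let P_linear phi psi : linear phi -> linear psi -> linear (P phi psi).
Proof. by move=> h h'; exact: (tlift_linear (bilin_mulK h h')). Qed.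

Let P_pure phi psi a b : linear phi -> linear psi ->
  P phi psi (a ⊗ b) = phi a * psi b.
Proof. by move=> h h'; exact: (tliftE _ _ (bilin_mulK h h')). Qed.

Let sum_sign (F : bool -> bool -> K) :
  \sum_(i : bool) \sum_(j : bool) ksign i j * F i j =
  F false false + F false true + F true false - F true true.
Proof. by rewrite !big_bool_add /= !expr0 !mul1r expr1 mulN1r addrA. Qed.

Let tens_eval_hom s t phi psi x : hom_dual s phi -> hom_dual t psi ->
  tens_eval phi psi x = ksign s t * P phi psi x.
Proof.
move=> hs ht; rewrite /tens_eval /P /tlift mulr_sumr; apply: eq_bigr => p _.
rewrite sum_sign !hs !ht; case: s t {hs ht} => [] [] /=;
by rewrite ?(mulr0, mul0r, subr0, sub0r, add0r, addr0, expr0, expr1, mul1r, mulN1r, oppr0).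
Qed.

Let P_tmul s t phi psi x y : is_deriv phi -> is_deriv psi ->
  hom_dual s phi -> hom_dual t psi ->
  P phi psi (tmul *%R *%R x y) =
    P phi psi x * P (pt_ev e) (pt_ev e) y
    + P phi (pt_ev e) x * P (pt_ev e) psi y
    + ksign s t * (P (pt_ev e) psi x * P phi (pt_ev e) y)
    + P (pt_ev e) (pt_ev e) x * P phi psi y.
Proof.
move=> [hl hM] [kl kM] hs ht.
have L := P_linear hl kl.
rewrite /tmul (lin_tlift _ _ L) !{2 4 6 8}/P {1}/tlift.
have D (a b c d : G -> K^o) :
    P a b x * P c d y = \sum_(p <- repr x) \sum_(q <- repr y)
      a p.1 * b p.2 * (c q.1 * d q.2).
  by rewrite /P /tlift big_distrlr.
rewrite !D mulr_sumr -!big_split; apply: eq_bigr => p _ /=.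
rewrite (lin_tlift _ _ L) mulr_sumr -!big_split; apply: eq_bigr => q _ /=.
rewrite (lin_sum L); under eq_bigr => i _ do rewrite (lin_sum L).
under eq_bigr => i _ do under eq_bigr => j _ do rewrite (linZ L) P_pure // hM kM.
rewrite [LHS]sum_sign !hs !ht /=.
have ce (f : G) : counit (spart false f) = counit f :> K := pt_even e f.
have co (f : G) : counit (spart true f) = 0 :> K by exact: (hopf_counit_even (OG_hopf G)).
rewrite !ce !co.
by case: s t {hs ht} => [] [] /=; ring.
Qed.

Lemma bracket_deriv s t phi psi : is_deriv phi -> is_deriv psi ->
  hom_dual s phi -> hom_dual t psi ->
  is_deriv (conv phi psi - ksign s t *: conv psi phi).
Proof.
move=> dphi dpsi hs ht.
have [hl _] := dphi; have [kl _] := dpsi.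
have H := OG_hopf G.
have el := pt_linear e.
have eE : pt_ev e = @counit _ G by [].
have Pee f : P (pt_ev e) (pt_ev e) (comul f) = e f.
  have := congr1 (fun g : points G => g f) (mul1g e); exact.
have Pl (a : G -> K^o) f : linear a -> P a (pt_ev e) (comul f) = a f.
  move=> al; have ef : tlift (fun a b => counit b *: a) (comul f) = f.
    exact: (hopf_counitr H).
  rewrite -{2}ef [RHS](lin_tlift _ _ al); apply: eq_bigr => p _.
  by rewrite (linZ al) mulrC.
have Pr (a : G -> K^o) f : linear a -> P (pt_ev e) a (comul f) = a f.
  move=> al; have ef : tlift (fun a b => counit a *: b) (comul f) = f.
    exact: (hopf_counitl H).
  by rewrite -{2}ef [RHS](lin_tlift _ _ al); apply: eq_bigr => p _; rewrite (linZ al).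
pose B f : K := ksign s t * P phi psi (comul f) - P psi phi (comul f).
have sq : ksign s t * ksign s t = 1 :> K by rewrite -expr2 sqrr_sign.
have -> : conv phi psi - ksign s t *: conv psi phi = B.
  apply: funext => f; rewrite /B.
  have -> : (conv phi psi - ksign s t *: conv psi phi) f =
     conv phi psi f - ksign s t * conv psi phi f by [].
  rewrite /conv (tens_eval_hom _ hs ht) (tens_eval_hom _ ht hs).
  by rewrite [t && s]andbC mulrA sq mul1r.
split.
  move=> a u v; rewrite /B !comul_linear (P_linear hl kl) (P_linear kl hl).
  by rewrite /GRing.scale /=; ring.
move=> f f'; rewrite /B.
have -> : comul (f * f') = tmul *%R *%R (comul f) (comul f').
  exact: (hopf_comul_mul H).
rewrite (P_tmul _ _ dphi dpsi hs ht) (P_tmul _ _ dpsi dphi ht hs) [t && s]andbC.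
rewrite !Pee !Pl // !Pr //.
move: (P phi psi _) (P phi psi _) (P psi phi _) (P psi phi _) => a b c d.
move: (phi f) (phi f') (psi f) (psi f') (e f) (e f') => p p' q q' u u'.
by case: (s && t); ring.
Qed.

Lemma lie_subproof (X Y : LieG) :
  \sum_(i : bool) \sum_(j : bool)
    (conv (dual_part i X) (dual_part j Y)
     - ksign i j *: conv (dual_part j Y) (dual_part i X)) \in tangent_pred.
Proof.
apply: rpred_sum => i _; apply: rpred_sum => j _; apply/asboolP/tangentP.
have dX k : is_deriv (dual_part k X).
  by apply/tangentP/tangent_part_subproof; case: X => X /= /asboolP.
have dY k : is_deriv (dual_part k Y).
  by apply/tangentP/tangent_part_subproof; case: Y => Y /= /asboolP.
by apply: bracket_deriv => //; apply: hom_dual_part; exact: tangent_linear.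
Qed.

(* [X, Y] = X ⋆ Y - (-1)^(|X||Y|) Y ⋆ X, summed over homogeneous components *)
Definition lie (X Y : LieG) : LieG := Tangent (lie_subproof X Y).

(* Δ(φ)(f ⊗ f') for Δ(φ) in D(G) ⊗ D(G) ⊂ (O(G) ⊗ O(G))^* *)
Definition dist_pairing (T : tens dist dist) (f f' : G) : K :=
  tlift (fun phi psi : dist => tens_eval phi psi (f ⊗ f')) T.

Record is_dist_hopf (H : hopfOps dist) : Prop := {
  dist_hopf : is_hopf_superalgebra H;
  dist_hopf_mul : forall phi psi : dist,
    hmul H phi psi = conv phi psi :> (G -> K^o);
  dist_hopf_one : hone H = pt_ev 1%g :> (G -> K^o);
  dist_hopf_comul : forall (phi : dist) f f',
    dist_pairing (hcomul H phi) f f' = phi (f * f');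
  dist_hopf_counit : forall phi : dist, hcounit H phi = phi 1;
  dist_hopf_anti : forall (phi : dist) f, hanti H phi f = phi (anti f)
}.

(* The group algebra is purely even. *)
Definition grpalg := {freeg (points G) / K}.
HB.instance Definition _ := GRing.Lmodule.on grpalg.

Definition grp_elt (g : points G) : grpalg := << g >>.

Definition grpalg_part (i : bool) (v : grpalg) : grpalg := if i then 0 else v.

Lemma grpalg_part_linear i : linear (grpalg_part i).
Proof. by case: i => // a u v; rewrite /grpalg_part scaler0 addr0. Qed.

Lemma grpalg_part_idem i j v :
  grpalg_part i (grpalg_part j v) = if i == j then grpalg_part j v else 0.
Proof. by case: i; case: j. Qed.

Lemma grpalg_part_sum v : grpalg_part false v + grpalg_part true v = v.
Proof. exact: addr0. Qed.

HB.instance Definition _ := isSuper.Build K grpalg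
  grpalg_part_linear grpalg_part_idem grpalg_part_sum.

Record is_grpalg_hopf (H : hopfOps grpalg) : Prop := {
  grpalg_hopf : is_hopf_superalgebra H;
  grpalg_hopf_mul : forall g h,
    hmul H (grp_elt g) (grp_elt h) = grp_elt (g * h)%g;
  grpalg_hopf_one : hone H = grp_elt 1%g;
  grpalg_hopf_comul : forall g, hcomul H (grp_elt g) = grp_elt g ⊗ grp_elt g;
  grpalg_hopf_counit : forall g, hcounit H (grp_elt g) = 1;
  grpalg_hopf_anti : forall g, hanti H (grp_elt g) = grp_elt g^-1%g
}.

End Distributions.

Section Enveloping.
Variables (K : fieldType) (g : superVect K) (br : g -> g -> g).

Definition lie_map (B : superAlg K) (f : g -> B) : Prop :=
  [/\ linear f, parity_preserving f
    & forall i j x y, homog i x -> homog j y ->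
        f (br x y) = f x * f y - ksign i j *: (f y * f x)].

Definition is_enveloping (U : superAlg K) (iota : g -> U) : Prop :=
  lie_map iota /\
  forall (B : superAlg K) (f : g -> B), lie_map f ->
    exists! F : U -> B, superalg_morphism F /\ forall x, F (iota x) = f x.

Record is_enveloping_hopf (U : superAlg K) (iota : g -> U) (H : hopfOps U) : Prop := {
  env_hopf : is_hopf_superalgebra H;
  env_hopf_mul : forall X Y, hmul H X Y = X * Y;
  env_hopf_one : hone H = 1;
  env_hopf_comul : forall x, hcomul H (iota x) = iota x ⊗ 1 + 1 ⊗ iota x
}.

End Enveloping.

(* theta is the superalgebra isomorphism U(g) -> D(G,e) extending             *)
(* Lie(G) ⊂ D(G,e)                                                            *)
Record is_env_identification (K : fieldType) (G : supergroup K)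
    (U : superAlg K) (iota : LieG G -> U) (theta : U -> G -> K^o) : Prop := {
  ident_linear : linear theta;
  ident_inj : injective theta;
  ident_image : forall phi, dist_at 1%g phi <-> exists X, theta X = phi;
  ident_even : forall i X, theta (spart i X) = dual_part i (theta X);
  ident_one : theta 1 = pt_ev 1%g;
  ident_mul : forall X Y, theta (X * Y) = conv (theta X) (theta Y);
  ident_iota : forall x, theta (iota x) = x
}.

(* Main.v *)
Require Import Defs.
From HB Require Import structures.
From mathcomp Require Import all_boot all_algebra.
From mathcomp Require Import boolp functions freeg ring.

Set Implicit Arguments.
Unset Strict Implicit.
Unset Printing Implicit Defensive.

Import GRing.Theory.
Local Open Scope ring_scope.

(** All structures in sight are dual to the Hopf superalgebra O(G). Say that a
    super vector space V with an even bilinear form <v, f> on V x O(G) that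
    separates V is a Hopf dual of O(G) when its product, unit, coproduct,
    counit and antipode are adjoint to the coproduct, counit, product, unit and
    antipode of O(G). The axioms of a Hopf superalgebra are self-dual, so a Hopf
    dual is a Hopf superalgebra (hopf_dual_superalgebra). Since the form
    separates V, its operations are moreover determined by the form: they exist
    as soon as the transposed operations stay in V (hopf_dual_exists), and a
    bijection compatible with two forms is an isomorphism
    (hopf_dual_isomorphism). The Koszul signs enter only through the form tpair
    on V (x) W, whose compatibility with reassociation (tpair_tassoc) and with
    the interchange of the two middle tensor factors (adjoint_middle_four) is
    all that the axioms need.

    Four spaces are Hopf duals in this sense: D(G) by evaluation, U(g) through
    its identification with D(G,e), the group algebra by g |-> ev_g, and
    k|G| (x) U(g) by letting g (x) X act as ev_g * X, where * is convolution;
    the last form is the tensor form composed with the coproduct of O(G).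

    Two facts of geometry enter. Finite generation makes every power m_x^n of
    the ideal of a point have finite codimension, so that
    (f, f') |-> phi(f f') is a finite sum of products of distributions at x,
    which is the coproduct (dist_at_comul). And distributions at distinct
    points are independent, since a function can be 1 at one point and vanish
    to high order at the others (dist_at_independent); this shows that the
    forms on k|G| and on k|G| (x) U(g) separate.

    Translation by g carries D(G,e) onto D(G,g), so g (x) X |-> ev_g * X maps
    k|G| (x) U(g) onto D(G), and by independence bijectively; Psi is the
    inverse. The product formula is
    ev_g * X * ev_h * Y = ev_(gh) * (ev_(h^-1) * X * ev_h) * Y, and the tensor
    product coproduct is the adjoint of the product of O(G) because the
    coproduct of O(G) is multiplicative (hopf_dual_tcomul). *)

(** * Tensor products of super vector spaces *)

Definition even_linear (K : fieldType) (V W : superVect K) (f : V -> W) : Prop :=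
  linear f /\ parity_preserving f.

Section Parts.
Variables (K : fieldType) (V : superVect K).

Lemma even_linear_id : even_linear (@id V).
Proof. by []. Qed.

Lemma spartD i : {morph @spart K V i : u v / u + v}.
Proof. exact: linD (@spart_linear K V i). Qed.

Lemma homog_spart i (v : V) : homog i (spart i v).
Proof. by rewrite /homog spart_idem eqxx. Qed.

Lemma spart_homog i j (v : V) : homog j v -> spart i v = if i == j then v else 0.
Proof. by move=> <-; rewrite spart_idem. Qed.

End Parts.

Section Tensors.
Variable K : fieldType.

Section Pure.
Variables (U V : superVect K).

Lemma tpureDl (u u' : U) (v : V) : (u + u') ⊗ v = u ⊗ v + u' ⊗ v.
Proof. exact: linD ((tpure_bilin U V).1 v) u u'. Qed.

Lemma tpureDr (u : U) (v v' : V) : u ⊗ (v + v') = u ⊗ v + u ⊗ v'.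
Proof. exact: linD ((tpure_bilin U V).2 u) v v'. Qed.

Lemma tpureZl a (u : U) (v : V) : (a *: u) ⊗ v = a *: (u ⊗ v).
Proof. exact: linZ ((tpure_bilin U V).1 v) a u. Qed.

Lemma tpureZr a (u : U) (v : V) : u ⊗ (a *: v) = a *: (u ⊗ v).
Proof. exact: linZ ((tpure_bilin U V).2 u) a v. Qed.

Lemma tpure_suml I (r : seq I) (F : I -> U) (v : V) :
  (\sum_(i <- r) F i) ⊗ v = \sum_(i <- r) F i ⊗ v.
Proof. exact: (lin_sum ((tpure_bilin U V).1 v)). Qed.

Lemma tpure_sumr I (r : seq I) (u : U) (F : I -> V) :
  u ⊗ (\sum_(i <- r) F i) = \sum_(i <- r) u ⊗ F i.
Proof. exact: (lin_sum ((tpure_bilin U V).2 u)). Qed.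

Lemma tens_ind (P : tens U V -> Prop) :
  (forall x y, P x -> P y -> P (x + y)) -> (forall u v, P (u ⊗ v)) ->
  forall x, P x.
Proof.
move=> hD hP x; rewrite [x]tens_sum; elim/big_ind: _ => //.
by rewrite -(tpure0l U (0 : V)).
Qed.

Lemma tens_homog_ind (P : tens U V -> Prop) :
  (forall x y, P x -> P y -> P (x + y)) ->
  (forall i j u v, homog i u -> homog j v -> P (u ⊗ v)) -> forall x, P x.
Proof.
move=> hD hP; apply: tens_ind => // u v.
rewrite -(spart_sum u) -(spart_sum v) !(tpureDl, tpureDr).
have hQ i j : P (spart i u ⊗ spart j v) by apply: hP; exact: homog_spart.
by apply: (hD); apply: (hD); exact: hQ.
Qed.

Lemma spart_tpure c (u : U) (v : V) :
  spart c (u ⊗ v) = \sum_(i : bool) spart i u ⊗ spart (i (+) c) v.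
Proof. exact: tens_part_pure. Qed.

Lemma homog_tpure i j (u : U) (v : V) : homog i u -> homog j v ->
  homog (i (+) j) (u ⊗ v).
Proof.
move=> hu hv; rewrite /homog spart_tpure big_bool_add.
rewrite !(spart_homog _ hu) !(spart_homog _ hv).
by case: i j {hu hv} => [] [] /=; rewrite ?tpure0l ?tpure0r ?addr0 ?add0r.
Qed.

End Pure.

Section Maps.
Variables (U V U' V' : superVect K).

Lemma tmapE (f : U -> U') (g : V -> V') u v : linear f -> linear g ->
  tmap f g (u ⊗ v) = f u ⊗ g v.
Proof. by move=> hf hg; rewrite /tmap tliftE //; exact: bilin_tpureM. Qed.

Lemma tmap_linear (f : U -> U') (g : V -> V') : linear f -> linear g ->
  linear (tmap f g).
Proof. by move=> hf hg; apply: tlift_linear; exact: bilin_tpureM. Qed.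

End Maps.

Lemma tmap_id (U V : superVect K) : tmap id id =1 @id (tens U V).
Proof.
apply: tens_ext => //; first exact: tmap_linear.
by move=> u v; rewrite tmapE.
Qed.

Lemma tassoc_pure (U V W : superVect K) (u : U) (v : V) (w : W) :
  tassoc ((u ⊗ v) ⊗ w) = u ⊗ (v ⊗ w).
Proof. by rewrite tassocE tliftE //; exact: bilin_assoc. Qed.

Section Bilinear.
Variables (U V : superVect K) (W : lmodType K).
Implicit Types (b : U -> V -> W).

Lemma bilin_sum (I : Type) (r : seq I) (b : I -> U -> V -> W) :
  (forall i, bilin (b i)) -> bilin (fun u v => \sum_(i <- r) b i u v).
Proof.
move=> h; split=> [v a u u'|u a v v']; rewrite scaler_sumr -big_split /=;
  apply: eq_bigr => i _; [exact: (h i).1 | exact: (h i).2].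
Qed.

Lemma bilin_scale c b : bilin b -> bilin (fun u v => c *: b u v).
Proof.
by move=> [h1 h2]; split=> [v a u u'|u a v v'];
  rewrite (h1, h2) scalerDr !scalerA mulrC.
Qed.

Lemma bilin_comp (U' V' : superVect K) (b : U' -> V' -> W) (f : U -> U') (g : V -> V') :
  linear f -> linear g -> bilin b -> bilin (fun u v => b (f u) (g v)).
Proof.
by move=> hf hg [h1 h2]; split=> [v a u u'|u a v v']; rewrite (hf, hg) (h1, h2).
Qed.

Lemma linear_tlift (Z : lmodType K) (b : Z -> U -> V -> W) x :
  (forall u v, linear (fun z => b z u v)) -> linear (fun z => tlift (b z) x).
Proof.
move=> h a z z'; rewrite /tlift scaler_sumr -big_split.
by apply: eq_bigr => p _; exact: h.
Qed.

End Bilinear.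

Section MiddleFour.
Variables (U V U' V' : superVect K).

(** The product and the coproduct of a tensor product of superalgebras or
    supercoalgebras are those of the factors composed with this one map, so
    that it isolates the only sign in their definitions. *)
Definition middle_four : tens (tens U V) (tens U' V') -> tens (tens U U') (tens V V') :=
  tlift (fun x y => tlift (fun u v => tlift (fun u' v' =>
    \sum_(i : bool) \sum_(j : bool)
      ksign i j *: ((u ⊗ spart j u') ⊗ (spart i v ⊗ v'))) y) x).

Let inner_bilin (u : U) (v : V) : bilin (fun (u' : U') (v' : V') =>
  \sum_(i : bool) \sum_(j : bool)
    ksign i j *: ((u ⊗ spart j u') ⊗ (spart i v ⊗ v'))).
Proof.
apply: bilin_sum => i; apply: bilin_sum => j; apply: bilin_scale.
apply: (bilin_comp (f := fun u' => u ⊗ spart j u') (g := fun v' => spart i v ⊗ v')).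
- by move=> a x y; rewrite spart_linear (tpure_bilin _ _).2.
- by move=> a x y; rewrite (tpure_bilin _ _).2.
exact: tpure_bilin.
Qed.

Let outer_bilin (u' : U') (v' : V') : bilin (fun (u : U) (v : V) =>
  \sum_(i : bool) \sum_(j : bool)
    ksign i j *: ((u ⊗ spart j u') ⊗ (spart i v ⊗ v'))).
Proof.
apply: bilin_sum => i; apply: bilin_sum => j; apply: bilin_scale.
apply: (bilin_comp (f := fun u => u ⊗ spart j u') (g := fun v => spart i v ⊗ v')).
- by move=> a x y; rewrite (tpure_bilin _ _).1.
- by move=> a x y; rewrite spart_linear (tpure_bilin _ _).1.
exact: tpure_bilin.
Qed.

Let middle_bilin (y : tens U' V') : bilin (fun (u : U) (v : V) =>
  tlift (fun u' v' => \sum_(i : bool) \sum_(j : bool)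
      ksign i j *: ((u ⊗ spart j u') ⊗ (spart i v ⊗ v'))) y).
Proof. by apply: bilin_sum => p; exact: outer_bilin. Qed.

Let middle_four_bilin : bilin (fun (x : tens U V) (y : tens U' V') =>
  tlift (fun u v => tlift (fun u' v' =>
    \sum_(i : bool) \sum_(j : bool)
      ksign i j *: ((u ⊗ spart j u') ⊗ (spart i v ⊗ v'))) y) x).
Proof.
apply: bilin_tlift => [y|u v]; first exact: middle_bilin.
exact: (tlift_linear (inner_bilin u v)).
Qed.

Lemma middle_four_linear : linear middle_four.
Proof. exact: tlift_linear middle_four_bilin. Qed.

Lemma middle_four_tpure x y : middle_four (x ⊗ y) =
  tlift (fun u v => tlift (fun u' v' => \sum_(i : bool) \sum_(j : bool)
      ksign i j *: ((u ⊗ spart j u') ⊗ (spart i v ⊗ v'))) y) x.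
Proof. exact: tliftE middle_four_bilin. Qed.

Lemma middle_fourE u v u' v' : middle_four ((u ⊗ v) ⊗ (u' ⊗ v')) =
  \sum_(i : bool) \sum_(j : bool)
    ksign i j *: ((u ⊗ spart j u') ⊗ (spart i v ⊗ v')).
Proof. by rewrite middle_four_tpure (tliftE _ _ (middle_bilin _)) tliftE. Qed.

End MiddleFour.

Lemma tcomul_middle_four (U V : superVect K) (dU : U -> tens U U)
    (dV : V -> tens V V) x : linear dU -> linear dV ->
  tcomul dU dV x = middle_four (tmap dU dV x).
Proof.
move=> hU hV; rewrite /tmap (lin_tlift _ _ (@middle_four_linear _ _ _ _)).
by apply: eq_tlift => u v; rewrite middle_four_tpure.
Qed.

Lemma tmul_middle_four (U V : superVect K) (mU : U -> U -> U) (mV : V -> V -> V)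
    (x y : tens U V) : bilin mU -> bilin mV ->
  tmul mU mV x y = tmap (tlift mU) (tlift mV) (middle_four (x ⊗ y)).
Proof.
move=> hU hV; have lU := tlift_linear hU; have lV := tlift_linear hV.
have lt := tmap_linear lU lV.
rewrite middle_four_tpure (lin_tlift _ _ lt); apply: eq_tlift => u v.
rewrite (lin_tlift _ _ lt); apply: eq_tlift => u' v'.
rewrite (lin_sum lt); apply: eq_bigr => i _; rewrite (lin_sum lt).
by apply: eq_bigr => j _; rewrite (linZ lt) tmapE // !tliftE.
Qed.

End Tensors.

(** * Even pairings and their tensor products *)

Record pairing (K : fieldType) (V A : superVect K) := Pairing {
  pr :> V -> A -> K;
  pr_bilin : bilin (pr : V -> A -> K^o);
  pr_part : forall i v a, pr (spart i v) a = pr v (spart i a)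
}.

Definition separating (K : fieldType) (V A : superVect K) (b : pairing V A) :=
  forall v, (forall a, b v a = 0) -> v = 0.

Section Pairing.
Variables (K : fieldType) (V A : superVect K) (b : pairing V A).

Lemma pr_linl a : linear (b^~ a : V -> K^o). Proof. exact: (pr_bilin b).1. Qed.
Lemma pr_linr v : linear (b v : A -> K^o). Proof. exact: (pr_bilin b).2. Qed.

Lemma prDl u v a : b (u + v) a = b u a + b v a.
Proof. exact: (linD (pr_linl a)). Qed.
Lemma prDr u v a : b a (u + v) = b a u + b a v.
Proof. exact: (linD (pr_linr a)). Qed.
Lemma prZl c v a : b (c *: v) a = c * b v a.
Proof. exact: (linZ (pr_linl a)). Qed.
Lemma prZr c v a : b v (c *: a) = c * b v a.
Proof. exact: (linZ (pr_linr v)). Qed.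
Lemma pr0l a : b 0 a = 0. Proof. exact: (lin0 (pr_linl a)). Qed.
Lemma pr0r v : b v 0 = 0. Proof. exact: (lin0 (pr_linr v)). Qed.
Lemma prNl v a : b (- v) a = - b v a.
Proof. by rewrite -scaleN1r prZl mulN1r. Qed.
Lemma prBl u v a : b (u - v) a = b u a - b v a.
Proof. by rewrite prDl prNl. Qed.
Lemma prNr v a : b v (- a) = - b v a.
Proof. by rewrite -scaleN1r prZr mulN1r. Qed.
Lemma prBr u v a : b a (u - v) = b a u - b a v.
Proof. by rewrite prDr prNr. Qed.
Lemma pr_suml I (r : seq I) (F : I -> V) a :
  b (\sum_(i <- r) F i) a = \sum_(i <- r) b (F i) a.
Proof. exact: (lin_sum (pr_linl a)). Qed.
Lemma pr_sumr I (r : seq I) (F : I -> A) v :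
  b v (\sum_(i <- r) F i) = \sum_(i <- r) b v (F i).
Proof. exact: (lin_sum (pr_linr v)). Qed.

Lemma separating_inj : separating b -> forall u v, b u =1 b v -> u = v.
Proof.
move=> nd u v h; apply/eqP; rewrite -subr_eq0; apply/eqP; apply: nd => a.
by rewrite prBl h subrr.
Qed.

End Pairing.

Section TensorPairing.
Variables (K : fieldType) (V A W B : superVect K) (b : pairing V A) (c : pairing W B).

(** Each functional is moved past the arguments of those before it: on
    homogeneous arguments the sign is the one that tens_eval puts on a tensor
    product of functionals. *)
Definition tpair_fun (x : tens V W) (y : tens A B) : K :=
  tlift (fun v w => tlift (fun a a' => \sum_(i : bool) \sum_(j : bool)
    ksign i j * (b v (spart i a) * c w (spart j a')) : K^o) y) x.

Let inner_bilin v w : bilin (fun a a' => \sum_(i : bool) \sum_(j : bool)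
    ksign i j * (b v (spart i a) * c w (spart j a')) : K^o).
Proof.
apply: bilin_sum => i; apply: bilin_sum => j.
apply: (@bilin_scale _ _ _ (K^o : lmodType K) (ksign i j)).
apply: (bilin_mulK (f := fun a => b v (spart i a)) (g := fun a' => c w (spart j a'))).
  by move=> e x y; rewrite spart_linear pr_linr.
by move=> e x y; rewrite spart_linear pr_linr.
Qed.

Let outer_bilin a a' : bilin (fun v w => \sum_(i : bool) \sum_(j : bool)
    ksign i j * (b v (spart i a) * c w (spart j a')) : K^o).
Proof.
apply: bilin_sum => i; apply: bilin_sum => j.
apply: (@bilin_scale _ _ _ (K^o : lmodType K) (ksign i j)).
by apply: bilin_mulK; exact: pr_linl.
Qed.

Lemma tpair_fun_bilin : bilin (tpair_fun : _ -> _ -> K^o).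
Proof.
split=> [y|x]; first by apply: tlift_linear; apply: bilin_sum => p; exact: outer_bilin.
by apply: linear_tlift => v w; apply: tlift_linear.
Qed.

Lemma tpair_funE v w a a' : tpair_fun (v ⊗ w) (a ⊗ a') =
  \sum_(i : bool) \sum_(j : bool) ksign i j * (b v (spart i a) * c w (spart j a')).
Proof.
rewrite /tpair_fun tliftE ?tliftE //.
by apply: bilin_sum => p; exact: outer_bilin.
Qed.

Lemma tpair_fun_homog i j v w a a' : homog i a -> homog j a' ->
  tpair_fun (v ⊗ w) (a ⊗ a') = ksign i j * (b v a * c w a').
Proof.
move=> ha ha'; rewrite tpair_funE !big_bool_add.
rewrite !(spart_homog _ ha) !(spart_homog _ ha').
by case: i j {ha ha'} => [] []; rewrite /= ?pr0r ?(mulr0, mul0r, addr0, add0r).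
Qed.

Lemma tpair_fun_part i x y : tpair_fun (spart i x) y = tpair_fun x (spart i y).
Proof.
have [hl hr] := tpair_fun_bilin.
move: y; apply: tens_homog_ind => [y y' h h'|k l a a' ha ha'].
  by rewrite spartD !(linD (hr _)) h h'.
move: x; apply: tens_ind => [x x' h h'|v w].
  by rewrite spartD !(linD (hl _)) h h'.
rewrite (spart_homog _ (homog_tpure ha ha')) spart_tpure (lin_sum (hl _)).
under eq_bigr => m _ do rewrite (tpair_fun_homog _ _ ha ha') !pr_part
  (spart_homog _ ha) (spart_homog _ ha').
rewrite big_bool_add; have h0 := lin0 (hr (v ⊗ w)).
have hh := tpair_fun_homog v w ha ha'.
by case: i k l {ha ha'} hh => [] [] [] /= hh;
  rewrite ?hh ?pr0r ?h0 ?(mulr0, mul0r, addr0, add0r).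
Qed.

Definition tpair : pairing (tens V W) (tens A B) :=
  Pairing tpair_fun_bilin tpair_fun_part.

Lemma tpairE v w a a' : tpair (v ⊗ w) (a ⊗ a') =
  \sum_(i : bool) \sum_(j : bool) ksign i j * (b v (spart i a) * c w (spart j a')).
Proof. exact: tpair_funE. Qed.

Lemma tpair_tpure v w y : tpair (v ⊗ w) y =
  tlift (fun a a' => \sum_(i : bool) \sum_(j : bool)
    ksign i j * (b v (spart i a) * c w (spart j a')) : K^o) y.
Proof.
by apply: (tliftE (W := K^o)); apply: bilin_sum => p; exact: outer_bilin.
Qed.

Lemma tpair_homog i j v w a a' : homog i a -> homog j a' ->
  tpair (v ⊗ w) (a ⊗ a') = ksign i j * (b v a * c w a').
Proof. exact: tpair_fun_homog. Qed.

End TensorPairing.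

(* A tensor pairing must stay folded for the rewrite rules above to apply. *)
Arguments pr : simpl never.

(** Gram-Schmidt for a separating pairing. It replaces the choice of bases: a
    finite family can be expanded along vectors whose coefficients are read
    off by elements of A. *)
Lemma finite_rank_identity (K : fieldType) (V A : superVect K) (b : pairing V A)
    (us : seq V) : separating b ->
  exists s : seq (V * A), forall u, u \in us -> u = \sum_(p <- s) b u p.2 *: p.1.
Proof.
move=> nd; elim: us => [|u us [s hs]]; first by exists [::].
pose P v := \sum_(p <- s) b v p.2 *: p.1.
pose Pt a := \sum_(p <- s) b p.1 a *: p.2.
have adj v a : b (P v) a = b v (Pt a).
  rewrite pr_suml pr_sumr; apply: eq_bigr => p _.
  by rewrite prZl prZr mulrC.
have [/eqP|r0] := eqVneq (u - P u) 0.
  rewrite subr_eq0 => /eqP e; exists s => v /[!inE] /orP [/eqP -> //|/hs //].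
have [a ha] : exists a, b (u - P u) a != 0.
  apply: contrapT => h; move/eqP: r0; apply; apply: nd => a.
  by apply/eqP/negPn/negP => ha; apply: h; exists a.
(* Since b v (a - Pt a) = b (v - P v) a, the new term fixes u and kills the
   vectors that P already fixes. *)
exists (((b (u - P u) a)^-1 *: (u - P u), a - Pt a) :: s) => v.
rewrite big_cons /= prBr -adj -prBl inE => /orP [/eqP ->|hv].
  by rewrite scalerA mulfV // scale1r subrK.
by rewrite -(hs v hv) -/(P v) {1}/P -(hs v hv) subrr pr0l scale0r add0r.
Qed.

Section TensorPairingTheory.
Variables (K : fieldType) (V A W B : superVect K) (b : pairing V A) (c : pairing W B).

Lemma tpair_even_l x a a' : homog false a ->
  tpair b c x (a ⊗ a') = tlift (fun v w => b v a * c w a' : K^o) x.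
Proof.
have hb : bilin (fun v w => b v a * c w a' : K^o) by apply: bilin_mulK; exact: pr_linl.
move=> ha; move: x; apply: tens_ind => [x y h h'|v w].
  by rewrite prDl h h' (linD (tlift_linear hb)).
rewrite (tliftE _ _ hb) tpairE !big_bool_add !(spart_homog _ ha) /= !pr0r.
rewrite !(mul0r, mulr0, addr0) !expr0 !mul1r -mulrDr.
by rewrite -(prDr c) spart_sum.
Qed.

Lemma tpair_even_r x a a' : homog false a' ->
  tpair b c x (a ⊗ a') = tlift (fun v w => b v a * c w a' : K^o) x.
Proof.
have hb : bilin (fun v w => b v a * c w a' : K^o) by apply: bilin_mulK; exact: pr_linl.
move=> ha; move: x; apply: tens_ind => [x y h h'|v w].
  by rewrite prDl h h' (linD (tlift_linear hb)).
rewrite (tliftE _ _ hb) tpairE !big_bool_add !(spart_homog _ ha) /= !pr0r.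
rewrite !(mul0r, mulr0, addr0) !expr0 !mul1r -mulrDl.
by rewrite -(prDr b) spart_sum.
Qed.

Lemma tpair_even_vl v w a a' : homog false v ->
  tpair b c (v ⊗ w) (a ⊗ a') = b v a * c w a'.
Proof.
move=> hv; rewrite tpairE !big_bool_add -!pr_part hv (spart_homog _ hv) /= pr0l.
by rewrite !mul0r !mulr0 !addr0 !expr0 !mul1r -mulrDr -prDl spart_sum.
Qed.

Lemma tpair_even_vr v w a a' : homog false w ->
  tpair b c (v ⊗ w) (a ⊗ a') = b v a * c w a'.
Proof.
move=> hw; rewrite tpairE !big_bool_add -!pr_part hw (spart_homog _ hw) /= pr0l.
by rewrite !mulr0 !addr0 !expr0 !mul1r -mulrDl -prDl spart_sum.
Qed.

(** Functionals given without signs are also represented: the signs depend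
    only on the parities, so they can be moved into the vector. *)
Lemma unsigned_tensor v w : exists x, forall a a',
  tpair b c x (a ⊗ a') = b v a * c w a'.
Proof.
exists (\sum_(i : bool) \sum_(j : bool) ksign i j *: (spart i v ⊗ spart j w)).
move=> a a'; rewrite -(spart_sum a) -(spart_sum a') !(tpureDl, tpureDr) !prDr.
have E i j : tpair b c (\sum_(i : bool) \sum_(j : bool) ksign i j *: (spart i v ⊗ spart j w))
   (spart i a ⊗ spart j a') = b v (spart i a) * c w (spart j a').
  rewrite !big_bool_add !prDl !prZl.
  rewrite !(tpair_homog _ _ _ _ (homog_spart i a) (homog_spart j a')) !pr_part.
  rewrite !spart_idem.
  by case: i j => [] []; rewrite /= ?pr0r; ring.
by rewrite !E !mulrDl !mulrDr !addrA.
Qed.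

Lemma tpair_ext x y : (forall a a', tpair b c x (a ⊗ a') = tpair b c y (a ⊗ a')) ->
  tpair b c x =1 tpair b c y.
Proof.
by move=> h; apply: tens_ind => // z z' hz hz'; rewrite !prDr hz hz'.
Qed.

(** Expand the left factors along a finite family e_q with coefficients
    < . , a_q>; pairing with a_q (x) a' then isolates the right factor of e_q,
    up to a sign once a_q and a' are homogeneous. *)
Lemma tpair_separating : separating b -> separating c ->
  separating (tpair b c).
Proof.
move=> ndb ndc x hx.
have [s hs] := finite_rank_identity [seq p.1 | p <- repr x] ndb.
pose F a := \sum_(p <- repr x) b p.1 a *: p.2.
have -> : x = \sum_(q <- s) q.1 ⊗ F q.2.
  rewrite {1}[x]tens_sum big_seq.
  under eq_bigr => p hp do rewrite {1}(hs p.1 (map_f _ hp)) tpure_suml.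
  rewrite -big_seq exchange_big /=; apply: eq_bigr => q _; rewrite tpure_sumr.
  by apply: eq_bigr => p _; rewrite tpureZl tpureZr.
have F_homog i a : homog i a -> F a = 0.
  move=> ha; apply: ndc => a'; rewrite -(spart_sum a') prDr.
  suff h j : c (F a) (spart j a') = 0 by rewrite !h addr0.
  have := hx (a ⊗ spart j a'); rewrite [x in tpair _ _ x _]tens_sum pr_suml.
  under eq_bigr => p _ do rewrite (tpair_homog _ _ _ _ ha (homog_spart _ _)).
  rewrite -mulr_sumr => /eqP; rewrite mulf_eq0 signr_eq0 /= => /eqP e.
  by rewrite pr_suml -[RHS]e; apply: eq_bigr => p _; rewrite prZl.
have FD a a' : F (a + a') = F a + F a'.
  by rewrite -big_split; apply: eq_bigr => p _; rewrite prDr scalerDl.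
apply: big1 => q _; rewrite -(spart_sum q.2) FD.
by rewrite !(F_homog _ _ (homog_spart _ _)) addr0 tpure0r.
Qed.

End TensorPairingTheory.

(** No sign occurs in this condition, which is the reason why it is used for
    even maps only. *)
Definition adjoint (K : fieldType) (V V' A A' : superVect K) (b : pairing V A)
    (b' : pairing V' A') (f : V -> V') (f' : A' -> A) :=
  forall v a, b' (f v) a = b v (f' a).

Section Adjoints.
Variable K : fieldType.

Lemma adjoint_id (V A : superVect K) (b : pairing V A) : adjoint b b id id.
Proof. by []. Qed.

Lemma adjoint_linear (V V' A A' : superVect K) (b : pairing V A)
    (b' : pairing V' A') (f : V -> V') (f' : A' -> A) :
  separating b' -> adjoint b b' f f' -> linear f.
Proof.
move=> nd h a u v; apply: (separating_inj nd) => y.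
by rewrite h prDl prZl prDl prZl !h.
Qed.

Lemma adjoint_even (V V' A A' : superVect K) (b : pairing V A)
    (b' : pairing V' A') (f : V -> V') (f' : A' -> A) :
  separating b' -> adjoint b b' f f' -> parity_preserving f' -> even_linear f.
Proof.
move=> nd h ev; split; first exact: adjoint_linear nd h.
move=> i v; apply: (separating_inj nd) => y.
by rewrite h !pr_part h ev.
Qed.

Lemma adjoint_tmap (V V' A A' W W' B B' : superVect K)
    (b : pairing V A) (b' : pairing V' A') (c : pairing W B) (c' : pairing W' B')
    (f : V -> V') (f' : A' -> A) (g : W -> W') (g' : B' -> B) :
  linear f -> even_linear f' -> linear g -> even_linear g' ->
  adjoint b b' f f' -> adjoint c c' g g' ->
  adjoint (tpair b c) (tpair b' c') (tmap f g) (tmap f' g').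
Proof.
move=> lf [lf' ef'] lg [lg' eg'] hf hg x y.
have lt := tmap_linear lf lg; have lt' := tmap_linear lf' lg'.
move: y; apply: tens_homog_ind => [y y' h h'|i j a a' ha ha'].
  by rewrite (linD lt') !prDr h h'.
move: x; apply: tens_ind => [x x' h h'|v w]; first by rewrite (linD lt) !prDl h h'.
rewrite !tmapE // (tpair_homog _ _ _ _ ha ha') hf hg (@tpair_homog _ _ _ _ _ _ _ i j) //.
  by rewrite /homog -ef' ha.
by rewrite /homog -eg' ha'.
Qed.

(** Associativity maps on the two sides are compatible: both bracketings give
    one sign for each pair of arguments. *)
Lemma tpair_tassoc (V A W B U C : superVect K) (b : pairing V A) (c : pairing W B)
    (d : pairing U C) x y :
  tpair b (tpair c d) (tassoc x) (tassoc y) = tpair (tpair b c) d x y.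
Proof.
have L := @tassoc_linear K.
move: y; apply: tens_ind => [y y' h h'|y u]; first by rewrite (linD (L _ _ _)) !prDr h h'.
rewrite -(spart_sum u) tpureDr (linD (L _ _ _)) !prDr.
suff E k : tpair b (tpair c d) (tassoc x) (tassoc (y ⊗ spart k u)) =
    tpair (tpair b c) d x (y ⊗ spart k u) by rewrite !E.
have := homog_spart k u; move: (spart k u) => {}u hu.
move: y; apply: tens_homog_ind => [y y' h h'|i j a a' ha ha'].
  by rewrite tpureDl (linD (L _ _ _)) !prDr h h'.
move: x; apply: tens_ind => [x y h h'|x w]; first by rewrite (linD (L _ _ _)) !prDl h h'.
move: x; apply: tens_ind => [x y h h'|v v'].
  by rewrite tpureDl (linD (L _ _ _)) !prDl h h'.
rewrite !tassoc_pure (tpair_homog _ _ _ _ ha (homog_tpure ha' hu)).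
rewrite (tpair_homog _ _ _ _ ha' hu) (tpair_homog _ _ _ _ (homog_tpure ha ha') hu).
rewrite (tpair_homog _ _ _ _ ha ha').
by case: i j k {ha ha' hu} => [] [] [] /=; ring.
Qed.

(** On both sides a term carries one sign for every pair of arguments but the
    two that are interchanged, whose sign occurs twice and cancels. *)
Lemma adjoint_middle_four (V1 A1 V2 A2 V3 A3 V4 A4 : superVect K)
    (b1 : pairing V1 A1) (b2 : pairing V2 A2) (b3 : pairing V3 A3) (b4 : pairing V4 A4) :
  adjoint (tpair (tpair b1 b2) (tpair b3 b4)) (tpair (tpair b1 b3) (tpair b2 b4))
    (@middle_four _ _ _ _ _) (@middle_four _ _ _ _ _).
Proof.
have L := @middle_four_linear K.
move=> x y.
move: y; apply: tens_ind => [y y' h h'|y y']; first by rewrite (linD (L _ _ _ _)) !prDr h h'.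
move: y; apply: tens_homog_ind => [y z h h'|i j a1 a3 h1 h3].
  by rewrite tpureDl (linD (L _ _ _ _)) !prDr h h'.
move: y'; apply: tens_homog_ind => [y z h h'|k l a2 a4 h2 h4].
  by rewrite tpureDr (linD (L _ _ _ _)) !prDr h h'.
move: x; apply: tens_ind => [x y h h'|x x']; first by rewrite (linD (L _ _ _ _)) !prDl h h'.
move: x; apply: tens_ind => [x y h h'|v1 v2].
  by rewrite tpureDl (linD (L _ _ _ _)) !prDl h h'.
move: x'; apply: tens_ind => [x y h h'|v3 v4].
  by rewrite tpureDr (linD (L _ _ _ _)) !prDl h h'.
rewrite !middle_fourE pr_suml pr_sumr.
have E m n : tpair (tpair b1 b3) (tpair b2 b4)
    ((v1 ⊗ spart n v3) ⊗ (spart m v2 ⊗ v4)) ((a1 ⊗ a3) ⊗ (a2 ⊗ a4)) =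
    ksign (i (+) j) (k (+) l) * (ksign i j * ksign k l) *
    ((n == j)%:R * (m == k)%:R) * (b1 v1 a1 * b2 v2 a2 * b3 v3 a3 * b4 v4 a4).
  rewrite (tpair_homog _ _ _ _ (homog_tpure h1 h3) (homog_tpure h2 h4)).
  rewrite (tpair_homog _ _ _ _ h1 h3) (tpair_homog _ _ _ _ h2 h4) !pr_part.
  rewrite (spart_homog _ h3) (spart_homog _ h2).
  by case: eqP; case: eqP; rewrite /= ?pr0r => _ _; ring.
have E' m n : tpair (tpair b1 b2) (tpair b3 b4) ((v1 ⊗ v2) ⊗ (v3 ⊗ v4))
    ((a1 ⊗ spart n a2) ⊗ (spart m a3 ⊗ a4)) =
    ksign (i (+) k) (j (+) l) * (ksign i k * ksign j l) *
    ((n == k)%:R * (m == j)%:R) * (b1 v1 a1 * b2 v2 a2 * b3 v3 a3 * b4 v4 a4).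
  rewrite (spart_homog _ h3) (spart_homog _ h2).
  case: eqP; case: eqP; rewrite /= => _ _; try by rewrite !(tpure0l, tpure0r) pr0r; ring.
  rewrite (tpair_homog _ _ _ _ (homog_tpure h1 h2) (homog_tpure h3 h4)).
  by rewrite (tpair_homog _ _ _ _ h1 h2) (tpair_homog _ _ _ _ h3 h4); ring.
rewrite !big_bool_add !prDl !prDr !prZl !prZr !E !E'.
by case: i j k l {h1 h2 h3 h4 E E'} => [] [] [] [] /=; ring.
Qed.

End Adjoints.

(** * Hopf superalgebras dual to a given one *)

Lemma hopf_mul_even (K : fieldType) (A : superVect K) (H : hopfOps A) :
  is_hopf_superalgebra H -> even_linear (tlift (hmul H)).
Proof.
move=> hH; have lm := tlift_linear (hopf_mul_bilin hH).
have mE a a' := tliftE a a' (hopf_mul_bilin hH).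
split=> // i; apply: tens_homog_ind => [x y h h'|j l u v hu hv].
  by rewrite spartD !(linD lm) h h' spartD.
rewrite (spart_homog _ (homog_tpure hu hv)) mE.
rewrite (spart_homog _ (hopf_mul_part hH hu hv)).
by case: eqP; rewrite ?mE // (lin0 lm).
Qed.

Lemma hopf_comul_even_linear (K : fieldType) (A : superVect K) (H : hopfOps A) :
  is_hopf_superalgebra H -> even_linear (hcomul H).
Proof. by move=> h; split; [exact: hopf_comul_linear h | exact: hopf_comul_even h]. Qed.

Record hopf_dual (K : fieldType) (V A : superVect K) (b : pairing V A)
    (HA : hopfOps A) (H : hopfOps V) : Prop := {
  dual_mul : forall u v a, b (hmul H u v) a = tpair b b (u ⊗ v) (hcomul HA a);
  dual_one : forall a, b (hone H) a = hcounit HA a;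
  dual_comul : forall v a a',
    tpair b b (hcomul H v) (a ⊗ a') = b v (hmul HA a a');
  dual_counit : forall v, hcounit H v = b v (hone HA);
  dual_anti : forall v a, b (hanti H v) a = b v (hanti HA a)
}.

(** Stated for a bare product, because the full dual of A has a convolution
    product but in general no coproduct. *)
Lemma dual_mulA (K : fieldType) (V A : superVect K) (b : pairing V A)
    (m : V -> V -> V) (d : A -> tens A A) :
  separating b -> even_linear d ->
  (forall a, tassoc (tmap d id (d a)) = tmap id d (d a)) ->
  (forall u v a, b (m u v) a = tpair b b (u ⊗ v) (d a)) -> associative m.
Proof.
move=> sep ed coassoc hm u v w; have inj := separating_inj sep.
have mb : bilin m.
  split=> [x c y z|x c y z]; apply: inj => a; rewrite prDl prZl !hm.
    by rewrite tpureDl tpureZl prDl prZl.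
  by rewrite tpureDr tpureZr prDl prZl.
have lm := tlift_linear mb.
have adj : adjoint (tpair b b) b (tlift m) d.
  move=> x a; move: x; apply: tens_ind => [x y h h'|x y].
    by rewrite (linD lm) !prDl h h'.
  by rewrite tliftE ?hm.
have idV := even_linear_id V; have idA := even_linear_id A.
apply: inj => a.
have L := adjoint_tmap lm ed idV.1 idA adj (adjoint_id b).
have R := adjoint_tmap idV.1 idA lm ed (adjoint_id b) adj.
have := L ((u ⊗ v) ⊗ w) (d a); have := R (u ⊗ (v ⊗ w)) (d a).
rewrite !tmapE // -coassoc -tassoc_pure tpair_tassoc => <-.
by rewrite !tliftE // !hm.
Qed.

Section DualHopf.
Variables (K : fieldType) (V A : superVect K) (b : pairing V A).
Variables (HA : hopfOps A) (H : hopfOps V).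
Hypotheses (sep : separating b) (hA : is_hopf_superalgebra HA)
  (D : hopf_dual b HA H).

Let inj := separating_inj sep.
Let sep2 := tpair_separating sep sep.
Let inj2 := separating_inj sep2.
Let mA := tlift (hmul HA).

Let lmA : linear mA. Proof. exact: tlift_linear (hopf_mul_bilin hA). Qed.
Let mAE a a' : mA (a ⊗ a') = hmul HA a a'.
Proof. exact: tliftE (hopf_mul_bilin hA). Qed.

Let emA : even_linear mA. Proof. exact: hopf_mul_even. Qed.
Let ecA : even_linear (hcomul HA). Proof. exact: hopf_comul_even_linear. Qed.
Let eSA : even_linear (hanti HA).
Proof. by split; [exact: hopf_anti_linear hA | exact: hopf_anti_even hA]. Qed.
Let ecounitA i a : hcounit HA (spart i a) = if i then 0 else hcounit HA a.
Proof.
have lc : linear (hcounit HA : A -> K^o) := hopf_counit_linear hA.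
case: i; first by rewrite (hopf_counit_even hA).
by rewrite -[in RHS](spart_sum a) (linD lc) (hopf_counit_even hA) addr0.
Qed.

Let mul_bilin : bilin (hmul H).
Proof.
split=> [v c u u'|u c v v']; apply: inj => a; rewrite prDl prZl !(dual_mul D).
  by rewrite tpureDl tpureZl prDl prZl.
by rewrite tpureDr tpureZr prDl prZl.
Qed.

Let mV := tlift (hmul H).
Let mVE u v : mV (u ⊗ v) = hmul H u v. Proof. exact: tliftE mul_bilin. Qed.
Let lmV : linear mV. Proof. exact: tlift_linear mul_bilin. Qed.

Let adj_mul : adjoint (tpair b b) b mV (hcomul HA).
Proof.
move=> x a; move: x; apply: tens_ind => [x y h h'|u v].
  by rewrite (linD lmV) !prDl h h'.
by rewrite mVE (dual_mul D).
Qed.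

Lemma dual_comul_adjoint : adjoint b (tpair b b) (hcomul H) (tlift (hmul HA)).
Proof.
move=> v; apply: tens_ind => [x y h h'|a a']; first by rewrite -/mA (linD lmA) !prDr h h'.
by rewrite (tliftE _ _ (hopf_mul_bilin hA)) (dual_comul D).
Qed.
Let adj_comul : adjoint b (tpair b b) (hcomul H) mA := dual_comul_adjoint.

Let adj_anti : adjoint b b (hanti H) (hanti HA).
Proof. exact: dual_anti D. Qed.

Let ec : even_linear (hcomul H).
Proof. exact: adjoint_even sep2 adj_comul emA.2. Qed.
Let eS : even_linear (hanti H).
Proof. exact: adjoint_even sep adj_anti eSA.2. Qed.

Let one_even : homog false (hone HA). Proof. exact: hopf_one_even hA. Qed.

(** Each axiom for H is the transpose of an axiom for HA: associativity and
    coassociativity are exchanged, and so are the unit and counit axioms; the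
    compatibility of product and coproduct and the antipode axioms are
    transposed to themselves. *)
Theorem hopf_dual_superalgebra : is_hopf_superalgebra H.
Proof.
have idV := even_linear_id V; have idA := even_linear_id A.
have lc : linear (hcounit HA : A -> K^o) := hopf_counit_linear hA.
split.
- exact: mul_bilin.
- exact: dual_mulA sep ecA (hopf_coassoc hA) (dual_mul D).
- move=> v; apply: inj => a; rewrite (dual_mul D).
  rewrite -[in RHS](hopf_counitl hA a) /tlift pr_sumr {1}[hcomul HA a]tens_sum pr_sumr.
  apply: eq_bigr => p _; rewrite prZr tpairE !big_bool_add !(dual_one D) !ecounitA /=.
  by rewrite !(mul0r, mulr0, addr0) !expr0 !mul1r -mulrDr -prDr spart_sum.
- move=> v; apply: inj => a; rewrite (dual_mul D).
  rewrite -[in RHS](hopf_counitr hA a) /tlift pr_sumr {1}[hcomul HA a]tens_sum pr_sumr.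
  apply: eq_bigr => p _; rewrite prZr tpairE !big_bool_add !(dual_one D) !ecounitA /=.
  by rewrite !(mul0r, mulr0, addr0) !expr0 !mul1r -mulrDl -prDr spart_sum mulrC.
- move=> i j u v hu hv; apply: inj => a; rewrite pr_part !(dual_mul D) ecA.2.
  by rewrite -pr_part (homog_tpure hu hv).
- by apply: inj => a; rewrite pr_part !(dual_one D) ecounitA.
- exact: ec.1.
- exact: ec.2.
- by move=> c u v; rewrite !(dual_counit D) prDl prZl.
- by move=> v; rewrite (dual_counit D) pr_part (spart_homog _ one_even) pr0r.
- move=> v; apply: (separating_inj (tpair_separating sep sep2)) => y.
  have R := adjoint_tmap idV.1 idA ec.1 emA (adjoint_id b) adj_comul.
  have L := adjoint_tmap ec.1 emA idV.1 idA adj_comul (adjoint_id b).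
  rewrite R; move: y; apply: tens_ind => [x y h h'|a].
    by rewrite (linD (tmap_linear idA.1 lmA)) !prDr h h'.
  apply: tens_ind => [x y h h'|a' a''].
    by rewrite tpureDr (linD (tmap_linear idA.1 lmA)) !prDr h h'.
  rewrite -tassoc_pure tpair_tassoc L tassoc_pure !tmapE // !adj_comul !mAE.
  by rewrite (hopf_mulA hA).
- move=> v; apply: inj => a; rewrite -[a in RHS](hopf_mul1l hA) -(dual_comul D).
  rewrite (tpair_even_l _ _ _ _ one_even) /tlift pr_suml; apply: eq_bigr => p _.
  by rewrite prZl (dual_counit D).
- move=> v; apply: inj => a; rewrite -[a in RHS](hopf_mul1r hA) -(dual_comul D).
  rewrite (tpair_even_r _ _ _ _ one_even) /tlift pr_suml; apply: eq_bigr => p _.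
  by rewrite prZl (dual_counit D) mulrC.
- move=> u v; apply: inj2; apply: tpair_ext => a a'.
  rewrite (dual_comul D) (dual_mul D) (hopf_comul_mul hA).
  rewrite (tmul_middle_four _ _ (hopf_mul_bilin hA) (hopf_mul_bilin hA)).
  rewrite (tmul_middle_four _ _ mul_bilin mul_bilin).
  rewrite (adjoint_tmap lmV ecA lmV ecA adj_mul adj_mul) tmapE; [|exact: ecA.1..].
  rewrite adjoint_middle_four -(adjoint_tmap ec.1 emA ec.1 emA adj_comul adj_comul).
  by rewrite tmapE //; exact: ec.1.
- apply: inj2; apply: tpair_ext => a a'.
  rewrite (dual_comul D) (dual_one D) (hopf_counit_mul hA) tpairE !big_bool_add.
  by rewrite !(dual_one D) !ecounitA /= !(mul0r, mulr0, addr0) expr0 mul1r.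
- move=> u v; rewrite !(dual_counit D) (dual_mul D) (hopf_comul_one hA).
  by rewrite (tpair_homog _ _ _ _ one_even one_even) expr0 mul1r.
- by rewrite (dual_counit D) (dual_one D) (hopf_counit_one hA).
- exact: eS.1.
- exact: eS.2.
- move=> v; apply: inj => a; rewrite prZl (dual_counit D) (dual_one D).
  have L := adjoint_tmap eS.1 eSA idV.1 idA adj_anti (adjoint_id b).
  have -> : tlift (fun x y => hmul H (hanti H x) y) (hcomul H v) =
      mV (tmap (hanti H) id (hcomul H v)).
    by rewrite (lin_tlift _ _ lmV); apply: eq_tlift => x y; rewrite mVE.
  rewrite adj_mul L adj_comul /tmap (lin_tlift _ _ lmA).
  have -> : tlift (fun x y => mA (hanti HA x ⊗ id y)) (hcomul HA a) =
      hcounit HA a *: hone HA.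
    by rewrite -(hopf_antil hA); apply: eq_tlift => x y; rewrite mAE.
  by rewrite prZr mulrC.
- move=> v; apply: inj => a; rewrite prZl (dual_counit D) (dual_one D).
  have L := adjoint_tmap idV.1 idA eS.1 eSA (adjoint_id b) adj_anti.
  have -> : tlift (fun x y => hmul H x (hanti H y)) (hcomul H v) =
      mV (tmap id (hanti H) (hcomul H v)).
    by rewrite (lin_tlift _ _ lmV); apply: eq_tlift => x y; rewrite mVE.
  rewrite adj_mul L adj_comul /tmap (lin_tlift _ _ lmA).
  have -> : tlift (fun x y => mA (id x ⊗ hanti HA y)) (hcomul HA a) =
      hcounit HA a *: hone HA.
    by rewrite -(hopf_antir hA); apply: eq_tlift => x y; rewrite mAE.
  by rewrite prZr mulrC.
Qed.

End DualHopf.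

(** The operations are chosen pointwise; their linearity and all other
    properties come for free from the pairing being separating. *)
Lemma hopf_dual_exists (K : fieldType) (V A : superVect K) (b : pairing V A)
    (HA : hopfOps A) :
  (forall u v, exists w, forall a, b w a = tpair b b (u ⊗ v) (hcomul HA a)) ->
  (exists w, forall a, b w a = hcounit HA a) ->
  (forall v, exists x, forall a a', tpair b b x (a ⊗ a') = b v (hmul HA a a')) ->
  (forall v, exists w, forall a, b w a = b v (hanti HA a)) ->
  exists H : hopfOps V, hopf_dual b HA H.
Proof.
move=> hm [one h1] hc hs.
pose m u v := projT1 (cid (hm u v)).
pose c v := projT1 (cid (hc v)).
pose s v := projT1 (cid (hs v)).
exists (HopfOps m one c (fun v => b v (hone HA)) s); split=> //=.
- by move=> u v a; rewrite /m; case: cid.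
- by move=> v a a'; rewrite /c; case: cid.
- by move=> v a; rewrite /s; case: cid.
Qed.

(** A bijection compatible with two pairings is automatically an isomorphism,
    because each structure map is determined by the pairing. *)
Lemma hopf_dual_isomorphism (K : fieldType) (V W A : superVect K)
    (b : pairing V A) (c : pairing W A) (HA : hopfOps A)
    (H : hopfOps V) (H' : hopfOps W) (f : V -> W) :
  separating c -> hopf_dual b HA H -> hopf_dual c HA H' ->
  bijective f -> (forall v a, c (f v) a = b v a) -> hopf_isomorphism H H' f.
Proof.
move=> sep D D' bij hf; have inj := separating_inj sep.
have adj : adjoint b c f id by [].
have idA := even_linear_id A.
have lf := adjoint_linear sep adj.
have adj2 := adjoint_tmap lf idA lf idA adj adj.
split=> //.
- exact: (adjoint_even sep adj idA.2).2.
- move=> u v; apply: inj => a; rewrite hf (dual_mul D) (dual_mul D').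
  by rewrite -tmapE // adj2 tmap_id.
- by apply: inj => a; rewrite hf (dual_one D) (dual_one D').
- move=> v; apply: (separating_inj (tpair_separating sep sep)).
  apply: tpair_ext => a a'.
  by rewrite adj2 tmap_id (dual_comul D) (dual_comul D') hf.
- by move=> v; rewrite (dual_counit D) (dual_counit D') hf.
by move=> v; apply: inj => a; rewrite hf (dual_anti D) (dual_anti D') hf.
Qed.

Lemma hopf_dual_transport (K : fieldType) (V W A : superVect K)
    (b : pairing V A) (c : pairing W A) (HA : hopfOps A) (H : hopfOps V) (f : V -> W) :
  separating c -> hopf_dual b HA H -> (forall v a, c (f v) a = b v a) ->
  (forall w, exists v, f v = w) -> exists H' : hopfOps W, hopf_dual c HA H'.
Proof.
move=> sep D hf surj; have idA := even_linear_id A.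
have adj : adjoint b c f id by [].
have lf := adjoint_linear sep adj.
have adj2 := adjoint_tmap lf idA lf idA adj adj.
apply: hopf_dual_exists.
- move=> u v; have [u' <-] := surj u; have [v' <-] := surj v.
  by exists (f (hmul H u' v')) => a; rewrite hf (dual_mul D) -tmapE // adj2 tmap_id.
- by exists (f (hone H)) => a; rewrite hf (dual_one D).
- move=> v; have [v' <-] := surj v; exists (tmap f f (hcomul H v')) => a a'.
  by rewrite adj2 tmap_id (dual_comul D) hf.
- move=> v; have [v' <-] := surj v; exists (f (hanti H v')) => a.
  by rewrite !hf (dual_anti D).
Qed.

(** With d the coproduct of A and b a tensor pairing, this is the convolution
    pairing, in which v (x) w acts as the product of v and w. *)
Definition comap_pairing (K : fieldType) (V A B : superVect K) (b : pairing V A)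
    (d : B -> A) (ed : even_linear d) : pairing V B.
Proof.
apply: (@Pairing _ _ _ (fun v a => b v (d a))).
  split=> [a c u v|v c u w]; first by rewrite prDl prZl.
  by rewrite ed.1 prDr prZr.
by move=> i v a; rewrite pr_part ed.2.
Defined.

Section TensorDual.
Variables (K : fieldType) (V W A : superVect K) (b : pairing V A) (c : pairing W A).
Variables (HA : hopfOps A) (HV : hopfOps V) (HW : hopfOps W).
Variables (HT : hopfOps (tens V W)).
Hypotheses (hA : is_hopf_superalgebra HA).
Let t := comap_pairing (tpair b c) (hopf_comul_even_linear hA).
Hypotheses (sepb : separating b) (sepc : separating c) (sept : separating t).
Hypotheses (DV : hopf_dual b HA HV) (DW : hopf_dual c HA HW) (DT : hopf_dual t HA HT).

(** This transposes the multiplicativity of the coproduct of A: the coproducts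
    of V and W are adjoint to the product of A, and the middle-four map is
    adjoint to itself. *)
Lemma hopf_dual_tcomul x : hcomul HT x = tcomul (hcomul HV) (hcomul HW) x.
Proof.
have adjV := dual_comul_adjoint hA DV; have adjW := dual_comul_adjoint hA DW.
have eA := hopf_mul_even hA; have edA := hopf_comul_even_linear hA.
have lV := adjoint_linear (tpair_separating sepb sepb) adjV.
have lW := adjoint_linear (tpair_separating sepc sepc) adjW.
have adjt : adjoint (tpair b c) t id (hcomul HA) by [].
have idT := even_linear_id (tens V W).
have adjtt := adjoint_tmap idT.1 edA idT.1 edA adjt adjt.
apply: (separating_inj (tpair_separating sept sept)); apply: tpair_ext => a a'.
rewrite (dual_comul DT) tcomul_middle_four // -[X in tpair t t X _]tmap_id adjtt.
rewrite (tmapE _ _ edA.1 edA.1) adjoint_middle_four (adjoint_tmap lV eA lW eA adjV adjW).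
rewrite -tmul_middle_four; [|exact: hopf_mul_bilin hA..].
by rewrite -(hopf_comul_mul hA).
Qed.

Lemma hopf_dual_tcounit x : hcounit HT x = tcounit (hcounit HV) (hcounit HW) x.
Proof.
rewrite (dual_counit DT) -[LHS]/(tpair b c x (hcomul HA (hone HA))).
rewrite (hopf_comul_one hA) (tpair_even_l _ _ _ _ (hopf_one_even hA)).
by apply: eq_bigr => p _; rewrite (dual_counit DV) (dual_counit DW).
Qed.

End TensorDual.

(** * Convolution and translations *)

(** The full dual of O(G) serves to transport identities between functionals,
    such as the associativity of convolution, from the theory of pairings. *)
Section FullDual.
Variables (K : fieldType) (G : supergroup K).

Definition lin_pred : {pred (G -> K^o)} := fun phi => `[< linear phi >].

Lemma lin_pred_closed : submod_closed lin_pred.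
Proof.
split; first by apply/asboolP => a u v; rewrite /GRing.zero /= scaler0 addr0.
move=> a u v /asboolP hu /asboolP hv; apply/asboolP.
by apply: lin_add => //; apply: lin_scale.
Qed.

HB.instance Definition _ := GRing.isSubmodClosed.Build K (G -> K^o) lin_pred
  (GRing.submod_closed_semi lin_pred_closed).

Record fdual := FDual { fdual_fun :> G -> K^o; fdual_proof : fdual_fun \in lin_pred }.
HB.instance Definition _ := [isSub for fdual_fun].
HB.instance Definition _ := [Choice of fdual by <:].
HB.instance Definition _ := [SubChoice_isSubLmodule of fdual by <:].

Lemma fdual_linear (phi : fdual) : linear phi.
Proof. by case: phi => phi /= /asboolP. Qed.

Lemma fdual_part_proof i (phi : fdual) : dual_part i phi \in lin_pred.
Proof. by apply/asboolP; apply: lin_part; exact: fdual_linear. Qed.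

Definition fdual_part i (phi : fdual) : fdual := FDual (fdual_part_proof i phi).

Lemma fdual_part_linear i : linear (fdual_part i).
Proof. by move=> a u v; apply: val_inj. Qed.

Lemma fdual_part_idem i j phi :
  fdual_part i (fdual_part j phi) = if i == j then fdual_part j phi else 0.
Proof.
apply: val_inj; rewrite /= (dual_part_idem _ _ (@fdual_linear phi)).
by case: (i == j).
Qed.

Lemma fdual_part_sum phi : fdual_part false phi + fdual_part true phi = phi.
Proof. by apply: val_inj; rewrite /= (dual_part_sum (@fdual_linear phi)). Qed.

HB.instance Definition _ :=
  isSuper.Build K fdual fdual_part_linear fdual_part_idem fdual_part_sum.

Definition mk_fdual phi (h : linear phi) : fdual := FDual (introT (asboolP _) h).

Lemma fdual_pairing_bilin : bilin (fun (phi : fdual) (f : G) => phi f : K^o).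
Proof. by split=> [f a u v|phi]; [|exact: fdual_linear]. Qed.

Definition fdual_pairing : pairing fdual G :=
  @Pairing K fdual G _ fdual_pairing_bilin (fun _ _ _ => erefl).

Lemma fdual_separating : separating fdual_pairing.
Proof. by move=> phi h; apply: val_inj; apply: funext => f; exact: h. Qed.

End FullDual.

Section Convolution.
Variables (K : fieldType) (G : supergroup K).
Implicit Types (phi psi chi : G -> K^o) (g h x : points G).

Let hG := OG_hopf G.

Lemma comul_even_linear : even_linear (@comul K G).
Proof. split; [exact: comul_linear | exact: (hopf_comul_even hG)]. Qed.

Lemma conv_tpair (V W : superVect K) (b : pairing V G) (c : pairing W G) v w f :
  conv (b v) (c w) f = tpair b c (v ⊗ w) (comul f).
Proof. by rewrite tpair_tpure. Qed.

Lemma conv_linear phi psi : linear phi -> linear psi -> linear (conv phi psi).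
Proof.
move=> h h' a u v.
have E f : conv phi psi f = tpair (fdual_pairing G) (fdual_pairing G)
    (mk_fdual h ⊗ mk_fdual h') (comul f) by rewrite -conv_tpair.
by rewrite !E comul_linear prDr prZr.
Qed.

Lemma convA phi psi chi : linear phi -> linear psi -> linear chi ->
  conv phi (conv psi chi) = conv (conv phi psi) chi.
Proof.
pose m (u v : fdual G) := mk_fdual (conv_linear (@fdual_linear _ _ u) (@fdual_linear _ _ v)).
have mA : associative m.
  apply: (dual_mulA (@fdual_separating _ G) comul_even_linear (hopf_coassoc hG)).
  by move=> u v a; rewrite -conv_tpair.
move=> h1 h2 h3.
by have /(congr1 val) := mA (mk_fdual h1) (mk_fdual h2) (mk_fdual h3).
Qed.

(** Comorphisms of the translations x |-> g x and x |-> x g. *)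
Definition transl g (f : G) : G := tlift (fun a b => g a *: b) (comul f).
Definition transr g (f : G) : G := tlift (fun a b => g b *: a) (comul f).

Lemma transl_bilin g : bilin (fun (a b : G) => g a *: b).
Proof.
split=> [v a u u'|u a v v']; last by rewrite scalerDr !scalerA mulrC.
by rewrite pt_linear scalerDl scalerA.
Qed.

Lemma transr_bilin g : bilin (fun (a b : G) => g b *: a).
Proof.
split=> [v a u u'|u a v v']; first by rewrite scalerDr !scalerA mulrC.
by rewrite pt_linear scalerDl scalerA.
Qed.

Lemma transl_linear g : linear (transl g).
Proof.
by move=> a u v; rewrite /transl comul_linear (tlift_linear (transl_bilin g)).
Qed.

Lemma transr_linear g : linear (transr g).
Proof.
by move=> a u v; rewrite /transr comul_linear (tlift_linear (transr_bilin g)).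
Qed.

Let pt_part g i f : g (spart i f) = if i then 0 else g f.
Proof. by case: i; [have [_ -> _ _] := pointP g | rewrite pt_even]. Qed.

Lemma conv_ptl g phi f : linear phi -> conv (pt_ev g) phi f = phi (transl g f).
Proof.
move=> h; rewrite /conv /tens_eval /transl (lin_tlift _ _ h).
apply: eq_tlift => a b; rewrite !big_bool_add /pt_ev !pt_part /=.
rewrite !(mul0r, mulr0, addr0) !expr0 !mul1r -mulrDr (linZ h).
by rewrite -[in RHS](spart_sum b) (linD h).
Qed.

Lemma conv_ptr g phi f : linear phi -> conv phi (pt_ev g) f = phi (transr g f).
Proof.
move=> h; rewrite /conv /tens_eval /transr (lin_tlift _ _ h).
apply: eq_tlift => a b; rewrite !big_bool_add /pt_ev !pt_part /=.
rewrite !(mul0r, mulr0, addr0) !expr0 !mul1r -mulrDl (linZ h) mulrC.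
by rewrite -[in RHS](spart_sum a) (linD h).
Qed.

Lemma transl_pt g h f : h (transl g f) = (g * h)%g f.
Proof.
rewrite -[RHS]/(pt_mul_fun g h f) /transl (lin_tlift _ _ (pt_linear h)); apply: eq_bigr => p _.
by rewrite (linZ (pt_linear h)).
Qed.

Lemma transr_pt g h f : g (transr h f) = (g * h)%g f.
Proof.
rewrite -[RHS]/(pt_mul_fun g h f) /transr (lin_tlift _ _ (pt_linear g)); apply: eq_bigr => p _.
by rewrite (linZ (pt_linear g)) /= mulrC.
Qed.

Lemma conv_pt g h : conv (pt_ev g) (pt_ev h) = pt_ev (g * h)%g.
Proof. by apply: funext => f; rewrite conv_ptl; [exact: transl_pt | exact: pt_linear]. Qed.

Lemma conv_1l phi : linear phi -> conv (pt_ev 1%g) phi = phi.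
Proof.
move=> h; apply: funext => f; rewrite conv_ptl //; congr (phi _).
exact: (hopf_counitl hG).
Qed.

Lemma conv_1r phi : linear phi -> conv phi (pt_ev 1%g) = phi.
Proof.
move=> h; apply: funext => f; rewrite conv_ptr //; congr (phi _).
exact: (hopf_counitr hG).
Qed.

Lemma comul_mul f f' : comul (f * f') = tmul *%R *%R (comul f) (comul f') :> tens G G.
Proof. exact: (hopf_comul_mul hG). Qed.

(** No sign appears because points vanish on odd functions. *)
Lemma translM g : {morph transl g : f f' / f * f'}.
Proof.
move=> f f'; have hb := transl_bilin g; have hl := tlift_linear hb.
have [_ _ _ gM] := pointP g.
rewrite /transl comul_mul /tmul (lin_tlift _ _ hl) [in RHS]/tlift mulr_suml.
apply: eq_bigr => p _; rewrite (lin_tlift _ _ hl) mulr_sumr.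
apply: eq_bigr => q _; rewrite !big_bool_add !(linD hl) !(linZ hl) !(tliftE _ _ hb).
rewrite !gM !pt_part /= !(mulr0, scale0r, scaler0, addr0) !expr0 !scale1r.
rewrite -scalerDr -mulrDl spart_sum -scalerAl -scalerAr scalerA.
by [].
Qed.

Lemma transrM g : {morph transr g : f f' / f * f'}.
Proof.
move=> f f'; have hb := transr_bilin g; have hl := tlift_linear hb.
have [_ _ _ gM] := pointP g.
rewrite /transr comul_mul /tmul (lin_tlift _ _ hl) [in RHS]/tlift mulr_suml.
apply: eq_bigr => p _; rewrite (lin_tlift _ _ hl) mulr_sumr.
apply: eq_bigr => q _; rewrite !big_bool_add !(linD hl) !(linZ hl) !(tliftE _ _ hb).
rewrite !gM !pt_part /= !(mul0r, scale0r, scaler0, addr0) !expr0 !scale1r.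
rewrite -scalerDr -mulrDr spart_sum -scalerAl -scalerAr scalerA.
by [].
Qed.

End Convolution.

(** * Distributions supported at a point *)

Section Ideals.
Variables (K : fieldType) (A : superAlg K).
Implicit Types (I J : A -> Prop).

Lemma idealX_mulr I n f g : idealX I n f -> idealX I n (f * g).
Proof.
elim: n f => // n IH f [s [hs ->]].
exists [seq (p.1, p.2 * g) | p <- s]; split.
  by move=> _ /mapP [p /hs [h1 h2] ->]; split=> //; exact: IH.
by rewrite big_map mulr_suml; apply: eq_bigr => p _; rewrite mulrA.
Qed.

Lemma idealX_mull I n f g : (forall f, I f -> I (g * f)) ->
  idealX I n f -> idealX I n (g * f).
Proof.
move=> hI; case: n => // n [s [hs ->]].
exists [seq (g * p.1, p.2) | p <- s]; split.
  by move=> _ /mapP [p /hs [h1 h2] ->]; split=> //; exact: hI.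
by rewrite big_map mulr_sumr; apply: eq_bigr => p _; rewrite mulrA.
Qed.

Lemma idealX_exp I n f : I f -> idealX I n (f ^+ n).
Proof. by move=> hf; elim: n => // n IH; rewrite exprS; apply: idealM_mul. Qed.

Lemma idealX_morph (B : superAlg K) I (J : B -> Prop) (F : A -> B) n f :
  linear F -> {morph F : x y / x * y} -> (forall x, I x -> J (F x)) ->
  idealX I n f -> idealX J n (F f).
Proof.
move=> lF mF hF; elim: n f => // n IH f [s [hs ->]].
exists [seq (F p.1, F p.2) | p <- s]; split.
  by move=> _ /mapP [p /hs [h1 h2] ->]; split; [exact: hF | exact: IH].
by rewrite (lin_sum lF) big_map; apply: eq_bigr => p _; rewrite mF.
Qed.

End Ideals.

Section DistAt.
Variables (K : fieldType) (G : supergroup K).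
Implicit Types (phi psi chi : G -> K^o) (g h x : points G).

Lemma vanish_mull x f f' : vanish x f' -> vanish x (f * f').
Proof. by have [_ _ _ xM] := pointP x; rewrite /vanish xM => ->; rewrite mulr0. Qed.

(** The map F is the comorphism of a map of G sending y to x; this moves
    distributions along translations and along the inverse. *)
Lemma dist_at_pullback x (y : points G) (F : G -> G) phi :
  linear F -> {morph F : f f' / f * f'} -> (forall f, y (F f) = x f) ->
  dist_at y phi -> dist_at x (phi \o F).
Proof.
move=> lF mF hF [l [n hn]]; split; first by move=> a u v; rewrite /= lF l.
exists n => f hf; apply: hn.
by apply: idealX_morph hf => // u; rewrite /vanish hF.
Qed.

Lemma dist_at_translate g h phi : dist_at h phi ->
  dist_at (g * h)%g (conv (pt_ev g) phi).
Proof.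
move=> d; have -> : conv (pt_ev g) phi = phi \o transl g.
  by apply: funext => f; rewrite conv_ptl //; exact: d.1.
by apply: dist_at_pullback d; [exact: transl_linear|exact: translM|exact: transl_pt].
Qed.

Lemma dist_at_translater g h phi : dist_at h phi ->
  dist_at (h * g)%g (conv phi (pt_ev g)).
Proof.
move=> d; have -> : conv phi (pt_ev g) = phi \o transr g.
  by apply: funext => f; rewrite conv_ptr //; exact: d.1.
apply: dist_at_pullback d; [exact: transr_linear|exact: transrM|move=> f; exact: transr_pt].
Qed.

Lemma dist_at_anti x phi : dist_at x phi -> dist_at x^-1%g (phi \o @anti K G).
Proof. by have [l _ _ m] := OG_anti G; exact: dist_at_pullback. Qed.

Lemma dist_at_pt x : dist_at x (pt_ev x).
Proof.
have [_ _ _ xM] := pointP x; split; first exact: pt_linear.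
exists 0%N => f [s [hs ->]]; rewrite /pt_ev (lin_sum (pt_linear x)) big_seq.
by apply: big1 => p /hs [h _]; rewrite xM h mul0r.
Qed.

Lemma dist_at_mulr x phi a : dist_at x phi -> dist_at x (fun f => phi (f * a)).
Proof.
move=> [l [n hn]]; split; first by move=> c u v; rewrite mulrDl -scalerAl l.
by exists n => f hf; apply: hn; exact: idealX_mulr.
Qed.

Lemma dist_at_mull x phi a : dist_at x phi -> dist_at x (fun f => phi (a * f)).
Proof.
move=> [l [n hn]]; split; first by move=> c u v; rewrite mulrDr -scalerAr l.
by exists n => f hf; apply: hn; apply: idealX_mull => // u; exact: vanish_mull.
Qed.

Definition subspace (P : G -> Prop) :=
  P 0 /\ forall a f f', P f -> P f' -> P (a *: f + f').

Lemma subspaceD P f f' : subspace P -> P f -> P f' -> P (f + f').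
Proof. by move=> [_ h] hf hf'; have := h 1 _ _ hf hf'; rewrite scale1r. Qed.

Lemma subspaceZ P a f : subspace P -> P f -> P (a *: f).
Proof. by move=> [h0 h] hf; have := h a _ _ hf h0; rewrite addr0. Qed.

(** The ideal of x is generated, as a right ideal, by the functions s - s(x)
    with s in a generating set of O(G), because
    f f' - x(f f') = (f - x(f)) f' + x(f) (f' - x(f')). *)
Lemma vanish_fingen x : exists s : seq G, (forall a, a \in s -> vanish x a) /\
  forall P, subspace P -> (forall a f, a \in s -> P (a * f)) ->
  forall f, P (f - x f *: 1).
Proof.
have [_ _ x1 xM] := pointP x; have xl := pt_linear x.
have [s hs] := OG_fingen G; exists [seq a - x a *: 1 | a <- s]; split.
  move=> _ /mapP [a _ ->]; rewrite /vanish (linD xl) -scaleNr (linZ xl) x1.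
  by rewrite /GRing.scale /= mulr1 subrr.
move=> P sP hP f; move: P sP hP.
move: f; apply: hs => [P sP hP|a f f' hf hf' P sP hP|f f' hf hf' P sP hP|a ha P sP hP].
- by rewrite x1 scale1r subrr; exact: sP.1.
- have -> : a *: f + f' - x (a *: f + f') *: 1 = a *: (f - x f *: 1) + (f' - x f' *: 1).
    by rewrite xl scalerDl scalerBr scalerA opprD addrACA.
  by apply: sP.2; [exact: hf | exact: hf'].
- have -> : f * f' - x (f * f') *: 1 = (f - x f *: 1) * f' + x f *: (f' - x f' *: 1).
    rewrite mulrBl -scalerAl mul1r scalerBr scalerA xM addrA subrK.
    by [].
  apply: subspaceD => //; last by apply: subspaceZ => //; exact: hf'.
  apply: (hf (fun u => P (u * f'))) => [|a u ha]; last by rewrite -mulrA; exact: hP.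
  split=> [|a u v hu hv]; first by rewrite mul0r; exact: sP.1.
  by rewrite mulrDl -scalerAl; exact: sP.2.
by rewrite -[_ - _]mulr1; apply: hP; apply/mapP; exists a.
Qed.

(** O(G) / m_x^n has finite dimension: if s spans it and the functions a generate
    m_x, then 1 and the products of the a with s span O(G) / m_x^(n+1). Saying
    that a subspace containing m_x^n and s is everything avoids the quotient. *)
Lemma idealX_cofinite x n : exists s : seq G, forall P, subspace P ->
  (forall f, idealX (vanish x) n f -> P f) -> (forall f, f \in s -> P f) ->
  forall f, P f.
Proof.
have [t [ht gen]] := vanish_fingen x.
elim: n => [|n [s hs]]; first by exists [::] => P _ h _ f; exact: h.
exists (1 :: [seq a * f | a <- t, f <- s]) => P sP hI hP f.
have P1 : P 1 by apply: hP; rewrite inE eqxx.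
rewrite -(subrK (x f *: 1) f); apply: subspaceD => //; last exact: subspaceZ.
apply: gen => // e u he; move: u; apply: (hs (fun u => P (e * u))).
- split=> [|a u v hu hv]; first by rewrite mulr0; exact: sP.1.
  by rewrite mulrDr -scalerAr; exact: sP.2.
- by move=> u hu; apply: hI; apply: idealM_mul => //; exact: ht.
move=> u hu; apply: hP; rewrite inE; apply/orP; right.
by apply/allpairsP; exists (e, u).
Qed.

(** The functionals f' |-> phi(f f') span a finite-dimensional space of
    distributions at x, as phi kills a power of m_x. Expanding them along finitely
    many xi_p gives phi(f f') = sum_p phi(f a_p) xi_p(f'), and f |-> phi(f a_p) is
    again a distribution at x. *)
Lemma dist_at_comul (V : superVect K) (b : pairing V G) x :
  separating b -> (forall xi, dist_at x xi -> exists v, forall f, b v f = xi f) ->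
  forall phi, dist_at x phi ->
  exists T, forall f f', tpair b b T (f ⊗ f') = phi (f * f').
Proof.
move=> sep im phi d; have [l [n hn]] := d.
have [s hs] := idealX_cofinite x n.+1.
pose v a := projT1 (cid (im _ (dist_at_mull a d))).
have vE a f : b (v a) f = phi (a * f) by rewrite /v; case: cid.
pose w a := projT1 (cid (im _ (dist_at_mulr a d))).
have wE a f : b (w a) f = phi (f * a) by rewrite /w; case: cid.
have [t ht] := finite_rank_identity [seq v a | a <- s] sep.
have E f f' : phi (f * f') = \sum_(p <- t) phi (f * p.2) * b p.1 f'.
  move: f; apply: hs => [|f hf|f hf].
  - split=> [|a f g hf hg].
      rewrite mul0r (lin0 l) big1 // => p _; by rewrite mul0r (lin0 l) mul0r.
    rewrite mulrDl -scalerAl l hf hg scaler_sumr -big_split.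
    apply: eq_bigr => p _; rewrite mulrDl -scalerAl l mulrDl /=.
    by rewrite /GRing.scale /= mulrA.
  - rewrite hn; last exact: idealX_mulr.
    by rewrite big1 // => p _; rewrite hn ?mul0r //; exact: idealX_mulr.
  rewrite -vE {1}(ht _ (map_f v hf)) pr_suml; apply: eq_bigr => p _.
  by rewrite prZl vE.
pose U p := projT1 (cid (unsigned_tensor b b (w p.2) p.1)).
exists (\sum_(p <- t) U p) => f f'.
rewrite pr_suml E; apply: eq_bigr => p _; rewrite /U; case: cid => T /= ->.
by rewrite wE.
Qed.

Lemma point_separation g h : g != h -> exists u, g u = 1 /\ h u = 0.
Proof.
move=> gh; have [f hf] : exists f, g f != h f.
  apply: contrapT => no; move/eqP: gh; apply; apply: point_ext => f.
  by apply/eqP/negPn/negP => hf; apply: no; exists f.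
have [_ _ g1 _] := pointP g; have [_ _ h1 _] := pointP h.
have e0 : g f - h f != 0 by rewrite subr_eq0.
exists ((g f - h f)^-1 *: (f - h f *: 1)).
rewrite -!scaleNr !(linZ (pt_linear _)) !(linD (pt_linear _)) !(linZ (pt_linear _)).
by rewrite g1 h1 /GRing.scale /= !mulr1 mulVf // subrr mulr0.
Qed.

(** The function u is 1 at g and vanishes to high order at the points of s.
    The factor a on the left makes the statement stable under multiplying
    cutoff functions, which need not commute. *)
Lemma dist_at_cutoff g (s : seq (points G)) (phi : points G -> G -> K^o) :
  g \notin s -> (forall h, h \in s -> dist_at h (phi h)) ->
  exists u, g u = 1 /\ forall h a f, h \in s -> phi h (a * (u * f)) = 0.
Proof.
have [_ _ g1 gM] := pointP g.
elim: s => [|h s IH]; first by exists 1.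
rewrite inE negb_or => /andP [gh gs] hd.
have [h' hs|u [gu hu]] := IH gs; first by apply: hd; rewrite inE hs orbT.
have [w [gw hw]] := point_separation gh.
have [l [n hn]] := hd h (mem_head _ _).
exists (w ^+ n.+1 * u); split=> [|h' a f].
  have gX m : g (w ^+ m) = 1 by elim: m => // m IHm; rewrite exprS gM gw IHm mulr1.
  by rewrite gM gX gu mulr1.
rewrite inE => /orP [/eqP ->|hs]; last by rewrite -mulrA mulrA; exact: hu.
apply: hn; apply: idealX_mull => [v|]; first exact: vanish_mull.
by rewrite -mulrA; apply: idealX_mulr; exact: idealX_exp.
Qed.

(** With a cutoff function u for the other points, phi_g(u f) = 0 for all f. But
    1 - u lies in m_g, so phi_g(f) = phi_g((1-u)^m f), which is 0 for large m. *)
Lemma dist_at_independent (s : seq (points G)) (phi : points G -> G -> K^o) :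
  uniq s -> (forall h, h \in s -> dist_at h (phi h)) ->
  (forall f, \sum_(h <- s) phi h f = 0) -> forall g, g \in s -> phi g = 0.
Proof.
move=> us hd h0 g gs.
have [l [n hn]] := hd g gs.
have [||u [gu hu]] := @dist_at_cutoff g (rem g s) phi.
- by rewrite mem_rem_uniq // inE eqxx.
- by move=> h /mem_rem; exact: hd.
have phiu f : phi g (u * f) = 0.
  have := h0 (u * f); rewrite (big_rem g) //= big1_seq ?addr0 // => h /andP [_ hh].
  by rewrite -[u * f]mul1r hu.
apply: funext => f; rewrite [RHS](_ : _ = 0) //.
have [_ _ g1 _] := pointP g.
have v1u : vanish g (1 - u).
  by rewrite /vanish -scaleN1r (linD (pt_linear g)) (linZ (pt_linear g)) g1 gu
    /GRing.scale /= mulr1 subrr.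
suff E m : phi g f = phi g ((1 - u) ^+ m * f).
  by rewrite (E n.+1); apply: hn; apply: idealX_mulr; exact: idealX_exp.
elim: m => [|m ->]; first by rewrite expr0 mul1r.
rewrite exprS -mulrA; move: (_ ^+ m * f) => y.
rewrite mulrBl mul1r -scaleN1r (linD l) (linZ l) phiu.
by rewrite scaler0 addr0.
Qed.

End DistAt.

(** * The Hopf superalgebra of distributions *)

Definition OG_ops (K : fieldType) (G : supergroup K) : hopfOps G :=
  HopfOps *%R 1 (@comul K G) (@counit K G) (@anti K G).

Section DistHopf.
Variables (K : fieldType) (G : supergroup K).

Lemma dist_pr_bilin : bilin (fun (phi : dist G) (f : G) => phi f : K^o).
Proof. by split=> [f a u v|phi]; [|exact: dist_linear]. Qed.

Definition dist_pr : pairing (dist G) G :=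
  @Pairing K (dist G) G _ dist_pr_bilin (fun _ _ _ => erefl).

Lemma dist_separating : separating dist_pr.
Proof. by move=> phi h; apply: val_inj; apply: funext => f; exact: h. Qed.

Lemma dist_at_dist g (phi : G -> K^o) : dist_at g phi -> phi \in @dist_pred K G.
Proof.
move=> d; apply/asboolP; exists [:: (g, phi)]; rewrite big_seq1; split=> // q.
by rewrite inE => /eqP ->.
Qed.

Lemma dist_ind (P : dist G -> Prop) : (forall u v, P u -> P v -> P (u + v)) ->
  (forall (g : points G) (phi : G -> K^o) (d : dist_at g phi),
    P (Dist (dist_at_dist d))) -> forall u, P u.
Proof.
move=> hD hP [phi hphi]; have /asboolP [s [hs e]] := hphi.
elim: s phi hphi hs e => [|q s IH] phi hphi hs e.
  have d0 : dist_at 1%g (0 : G -> K^o).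
    by rewrite -(scale0r (pt_ev 1%g)); apply: dist_at_scale; exact: dist_at_pt.
  suff <- : Dist (dist_at_dist d0) = Dist hphi by [].
  by apply: val_inj; rewrite /= e big_nil.
have hq := hs q (mem_head _ _).
have hs' q' : q' \in s -> dist_at q'.1 q'.2 by move=> h; apply: hs; rewrite inE h orbT.
have hr : \sum_(q <- s) q.2 \in @dist_pred K G by apply/asboolP; exists s.
have -> : Dist hphi = Dist (dist_at_dist hq) + Dist hr.
  by apply: val_inj; rewrite /= e big_cons.
by apply: hD => //; exact: IH.
Qed.

(** Translating phi on the left and psi on the right moves both to the
    identity, and their convolution there is translated back. *)
Lemma dist_at_conv (g h : points G) (phi psi : G -> K^o) :
  (forall phi psi : G -> K^o, dist_at 1%g phi -> dist_at 1%g psi ->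
    dist_at 1%g (conv phi psi)) ->
  dist_at g phi -> dist_at h psi -> dist_at (g * h)%g (conv phi psi).
Proof.
move=> he dg dh; have lp (x : points G) := pt_linear x.
have d1 := dist_at_translate g^-1%g dg; rewrite mulVg in d1.
have d2 := dist_at_translater h^-1%g dh; rewrite mulgV in d2.
have := dist_at_translater h (dist_at_translate g (he _ _ d1 d2)).
rewrite mulg1; have -> // : conv (conv (pt_ev g) (conv (conv (pt_ev g^-1%g) phi)
  (conv psi (pt_ev h^-1%g)))) (pt_ev h) = conv phi psi.
have [lphi lpsi] := (dg.1, dh.1).
have c1 := conv_linear (lp g^-1%g) lphi; have c2 := conv_linear lpsi (lp h^-1%g).
rewrite !convA //; try by do ?apply: conv_linear.
rewrite conv_pt mulgV conv_1l // -!convA //; try by do ?apply: conv_linear.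
by rewrite conv_pt mulVg conv_1r.
Qed.

(** Closure under convolution at the identity is a hypothesis: it comes from
    the product of U(g). *)
Lemma dist_hopf_dual :
  (forall phi psi : G -> K^o, dist_at 1%g phi -> dist_at 1%g psi ->
    dist_at 1%g (conv phi psi)) ->
  exists H, hopf_dual dist_pr (OG_ops G) H.
Proof.
move=> he; apply: hopf_dual_exists.
- apply: dist_ind => [u u' h h' v|g phi d].
    have [w hw] := h v; have [w' hw'] := h' v; exists (w + w') => a.
    by rewrite prDl tpureDl prDl hw hw'.
  apply: dist_ind => [v v' [w hw] [w' hw']|h psi d'].
    by exists (w + w') => a; rewrite prDl tpureDr prDl hw hw'.
  by exists (Dist (dist_at_dist (dist_at_conv he d d'))) => a; rewrite -conv_tpair.
- by exists (Dist (dist_at_dist (dist_at_pt 1%g))).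
- apply: dist_ind => [u u' [w hw] [w' hw']|g phi d].
    by exists (w + w') => a a'; rewrite !prDl hw hw'.
  have [|T hT] := dist_at_comul dist_separating _ d; last by exists T.
  by move=> xi dxi; exists (Dist (dist_at_dist dxi)).
apply: dist_ind => [u u' [w hw] [w' hw']|g phi d].
  by exists (w + w') => a; rewrite !prDl hw hw'.
by exists (Dist (dist_at_dist (dist_at_anti d))).
Qed.

Lemma hopf_dual_is_dist_hopf H : hopf_dual dist_pr (OG_ops G) H -> is_dist_hopf H.
Proof.
move=> D; split.
- exact: hopf_dual_superalgebra dist_separating (OG_hopf G) D.
- move=> phi psi; apply: funext => f.
  by rewrite -[LHS]/(dist_pr (hmul H phi psi) f) (dual_mul D) -conv_tpair.
- by apply: funext => f; exact: (dual_one D).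
- exact: (dual_comul D).
- exact: (dual_counit D).
- exact: (dual_anti D).
Qed.

End DistHopf.

(** * The group algebra *)

Section GroupAlgebra.
Variables (K : fieldType) (G : supergroup K).
Implicit Types (u v : grpalg G) (g h : points G).

(** Allows linear combinations with different supports to be indexed by a
    common set of points. *)
Lemma grpalg_sum (W : zmodType) (F : points G -> K -> W) u (s : seq (points G)) :
  (forall g, F g 0 = 0) -> uniq s -> {subset dom u <= s} ->
  \sum_(g <- dom u) F g (coeff g u) = \sum_(g <- s) F g (coeff g u).
Proof.
move=> F0 us hs; rewrite [RHS](bigID (fun g => g \in dom u)) /=.
rewrite [X in _ + X]big1 ?addr0 => [|g hg]; last by rewrite coeff_outdom.
rewrite -[RHS]big_filter; apply: perm_big; apply: uniq_perm.
- exact: uniq_dom.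
- exact: filter_uniq.
by move=> g; rewrite mem_filter; case: (boolP (g \in dom u)) => // /hs ->.
Qed.

Lemma grpalg_expand u (s : seq (points G)) : uniq s -> {subset dom u <= s} ->
  u = \sum_(g <- s) coeff g u *: grp_elt g.
Proof.
have E c g : << c *g g >> = c *: grp_elt g :> grpalg G.
  by apply/eqP/freeg_eqP => h; rewrite coeffZ !coeffU mul1r.
move=> us hs; rewrite -(grpalg_sum (F := fun g c => c *: grp_elt g)) //.
  by rewrite -{1}[u]freeg_sumE; apply: eq_bigr.
by move=> g; rewrite scale0r.
Qed.

Lemma grpalg_ind (P : grpalg G -> Prop) : (forall u v, P u -> P v -> P (u + v)) ->
  (forall c g, P (c *: grp_elt g)) -> forall u, P u.
Proof.
move=> hD hP u; rewrite [u](@grpalg_expand u (dom u)) ?uniq_dom //.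
elim/big_ind: _ => //; rewrite -(scale0r (grp_elt (1%g : points G))); exact: hP.
Qed.

Definition grpalg_eval u (f : G) : K := \sum_(g <- dom u) coeff g u * g f.

Lemma grpalg_evalE u f (s : seq (points G)) : uniq s -> {subset dom u <= s} ->
  grpalg_eval u f = \sum_(g <- s) coeff g u * g f.
Proof. by apply: (grpalg_sum (F := fun g c => c * g f)) => g; rewrite mul0r. Qed.

Lemma grpalg_eval_bilin : bilin (grpalg_eval : _ -> _ -> K^o).
Proof.
split=> [f a u v|u a f f'].
  pose s := undup (dom (a *: u + v) ++ dom u ++ dom v).
  have us : uniq s by exact: undup_uniq.
  rewrite !(@grpalg_evalE _ f s us);
    try by move=> g hg; rewrite mem_undup !mem_cat hg ?orbT.
  rewrite scaler_sumr -big_split; apply: eq_bigr => g _ /=.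
  by rewrite coeffD coeffZ mulrDl /GRing.scale /= mulrA.
rewrite /grpalg_eval scaler_sumr -big_split; apply: eq_bigr => g _ /=.
by rewrite pt_linear mulrDr /GRing.scale /= mulrCA.
Qed.

Lemma grpalg_eval_part i u f : grpalg_eval (spart i u) f = grpalg_eval u (spart i f).
Proof.
case: i; last by apply: eq_bigr => g _; rewrite pt_even.
rewrite -[spart true u]/(0 : grpalg G) (lin0 (grpalg_eval_bilin.1 f)).
by rewrite /grpalg_eval big1 // => g _; have [_ -> _ _] := pointP g; rewrite mulr0.
Qed.

Definition grpalg_pr : pairing (grpalg G) G := Pairing grpalg_eval_bilin grpalg_eval_part.

Lemma grpalg_prE g f : grpalg_pr (grp_elt g) f = g f.
Proof.
rewrite /= /grpalg_pr /pr /grpalg_eval domU1 big_seq1 coeffU eqxx mul1r.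
by rewrite mul1r.
Qed.

Lemma grpalg_pr_elt g : grpalg_pr (grp_elt g) = pt_ev g :> (G -> K).
Proof. by apply: funext => f; rewrite grpalg_prE. Qed.

(** Dedekind's independence of characters, as the case of point masses in the
    independence of distributions. *)
Lemma grpalg_separating : separating grpalg_pr.
Proof.
move=> u hu; apply/eqP/freeg_eqP => g; rewrite coeff0.
case: (boolP (g \in dom u)) => [hg|/coeff_outdom //].
have /(congr1 (fun F => F 1)) : coeff g u *: pt_ev g = 0 :> (G -> K^o).
  apply: (dist_at_independent (phi := fun g => coeff g u *: pt_ev g)) hg.
  - exact: uniq_dom.
  - by move=> h _; apply: dist_at_scale; exact: dist_at_pt.
  exact: hu.
have [_ _ g1 _] := pointP g.
by rewrite /GRing.scale /= /pt_ev g1 /GRing.scale /= mulr1.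
Qed.

Lemma grpalg_hopf_dual : exists H, hopf_dual grpalg_pr (OG_ops G) H.
Proof.
apply: hopf_dual_exists.
- apply: grpalg_ind => [u u' h h' v|c g].
    have [w hw] := h v; have [w' hw'] := h' v; exists (w + w') => a.
    by rewrite prDl tpureDl prDl hw hw'.
  apply: grpalg_ind => [v v' [w hw] [w' hw']|d h].
    by exists (w + w') => a; rewrite prDl tpureDr prDl hw hw'.
  exists ((c * d) *: grp_elt (g * h)%g) => a.
  rewrite tpureZl tpureZr !prZl grpalg_prE -conv_tpair !grpalg_pr_elt conv_pt.
  by rewrite -mulrA.
- by exists (grp_elt 1%g) => a; rewrite grpalg_prE.
- apply: grpalg_ind => [u u' [w hw] [w' hw']|c g].
    by exists (w + w') => a a'; rewrite !prDl hw hw'.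
  exists (c *: (grp_elt g ⊗ grp_elt g)) => a a'; rewrite !prZl tpair_even_vl //.
  by rewrite !grpalg_prE; have [_ _ _ ->] := pointP g.
apply: grpalg_ind => [u u' [w hw] [w' hw']|c g].
  by exists (w + w') => a; rewrite !prDl hw hw'.
by exists (c *: grp_elt g^-1%g) => a; rewrite !prZl !grpalg_prE.
Qed.

Lemma hopf_dual_is_grpalg_hopf H : hopf_dual grpalg_pr (OG_ops G) H -> is_grpalg_hopf H.
Proof.
move=> D; have inj := separating_inj grpalg_separating; split.
- exact: hopf_dual_superalgebra grpalg_separating (OG_hopf G) D.
- move=> g h; apply: inj => f.
  by rewrite (dual_mul D) -conv_tpair !grpalg_pr_elt conv_pt.
- by apply: inj => f; rewrite (dual_one D) grpalg_prE.
- move=> g; apply: (separating_inj (tpair_separating grpalg_separating grpalg_separating)).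
  apply: tpair_ext => a a'; rewrite (dual_comul D) tpair_even_vl // !grpalg_prE.
  by have [_ _ _ ->] := pointP g.
- by move=> g; rewrite (dual_counit D) grpalg_prE; have [_ _ -> _] := pointP g.
- by move=> g; apply: inj => f; rewrite (dual_anti D) !grpalg_prE.
Qed.

End GroupAlgebra.

(** * The decomposition of D(G) *)

Section Decomposition.
Variables (K : fieldType) (G : supergroup K) (U : superVect K) (b : pairing U G).
Hypotheses (sep : separating b)
  (im : forall phi : G -> K^o, dist_at 1%g phi <-> exists X, b X = phi).

Let T := tens (grpalg G) U.

(** This form makes g (x) X act as the convolution of ev_g and X. *)
Definition tens_pr : pairing T G :=
  comap_pairing (tpair (grpalg_pr G) b) (hopf_comul_even_linear (OG_hopf G)).

Lemma dist_at_one X : dist_at 1%g (b X). Proof. by apply/im; exists X. Qed.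

Lemma tens_prE g X : tens_pr (grp_elt g ⊗ X) = conv (pt_ev g) (b X) :> (G -> K).
Proof. by apply: funext => f; rewrite -grpalg_pr_elt conv_tpair. Qed.

Lemma dist_at_tens g X : dist_at g (conv (pt_ev g) (b X)).
Proof. by rewrite -[g in dist_at g]mulg1; apply: dist_at_translate; exact: dist_at_one. Qed.

Lemma grp_tens_expand (x : T) : exists (s : seq (points G)) (X : points G -> U),
  uniq s /\ x = \sum_(g <- s) grp_elt g ⊗ X g.
Proof.
pose s := undup (flatten [seq dom p.1 | p <- repr x]).
exists s, (fun g => \sum_(p <- repr x) coeff g p.1 *: p.2); split; first exact: undup_uniq.
rewrite {1}[x]tens_sum big_seq.
under eq_bigr => p hp.
  rewrite {1}(@grpalg_expand _ _ p.1 s) ?undup_uniq //; first last.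
    move=> g hg; rewrite mem_undup; apply/flattenP; exists (dom p.1) => //.
    by apply/mapP; exists p.
  rewrite tpure_suml; over.
rewrite -big_seq exchange_big /=; apply: eq_bigr => g _; rewrite tpure_sumr.
by apply: eq_bigr => p _; rewrite tpureZl tpureZr.
Qed.

Lemma conv_pt_inj g phi psi : linear phi -> linear psi ->
  conv (@pt_ev K G g) phi = conv (pt_ev g) psi -> phi = psi.
Proof.
move=> h h' /(congr1 (conv (pt_ev g^-1%g))).
have lp (x : points G) := pt_linear x.
by rewrite !convA // conv_pt mulVg !conv_1l.
Qed.

(** Write a tensor as a sum of g (x) X_g over distinct g: it acts as a sum of
    distributions at distinct points, so each ev_g * X_g vanishes, and then X_g
    does because translation is invertible. *)
Lemma tens_separating : separating tens_pr.
Proof.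
move=> x; have [s [X [us ->]]] := grp_tens_expand x => hx.
rewrite big_seq; apply: big1 => g gs.
have e : conv (pt_ev g) (b (X g)) = 0.
  apply: (dist_at_independent (phi := fun g => conv (pt_ev g) (b (X g))) us _ _ gs).
    by move=> h _; exact: dist_at_tens.
  move=> f; rewrite -[RHS](hx f) pr_suml; apply: eq_bigr => h _.
  by rewrite tens_prE.
suff -> : X g = 0 by rewrite tpure0r.
apply: sep => f; rewrite -(pr0l b f).
suff -> : b (X g) = b 0 :> (G -> K^o) by [].
apply: (@conv_pt_inj g); try exact: pr_linr.
rewrite e; apply: funext => f'; rewrite conv_ptl ?pr0l //; exact: pr_linr.
Qed.

Lemma tens_dist (x : T) : exists phi : dist G, tens_pr x = phi :> (G -> K).
Proof.
have [s [X [us ->]]] := grp_tens_expand x.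
exists (\sum_(g <- s) Dist (dist_at_dist (dist_at_tens g (X g)))).
apply: funext => f; rewrite pr_suml -[RHS]/(dist_pr G _ f) pr_suml.
by apply: eq_bigr => g _; rewrite tens_prE.
Qed.

Lemma dist_tens_at g phi : dist_at g phi -> exists X,
  b X = conv (pt_ev g^-1%g) phi /\ tens_pr (grp_elt g ⊗ X) = phi.
Proof.
move=> d; have := dist_at_translate g^-1%g d; rewrite mulVg => /im [X hX].
exists X; split=> //; rewrite tens_prE hX.
have lp (x : points G) := pt_linear x; have l := d.1.
by rewrite convA // conv_pt mulgV conv_1l.
Qed.

Lemma dist_tens (phi : dist G) : exists x : T, tens_pr x = phi :> (G -> K).
Proof.
move: phi; apply: dist_ind => [u v [x hx] [y hy]|g phi d].
  by exists (x + y); apply: funext => f; rewrite prDl hx hy.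
by have [X [_ hX]] := dist_tens_at d; exists (grp_elt g ⊗ X).
Qed.

End Decomposition.

(** * The enveloping superalgebra, and the theorem *)

Section Enveloping.
Variables (K : fieldType) (G : supergroup K) (U : superAlg K) (iota : LieG G -> U).
Variables (theta : U -> G -> K^o) (htheta : is_env_identification iota theta).

Lemma theta_dist_at X : dist_at 1%g (theta X).
Proof. by apply/(ident_image htheta); exists X. Qed.

Lemma theta_bilin : bilin theta.
Proof.
split=> [f a u v|X]; first by rewrite (ident_linear htheta).
by have [] := theta_dist_at X.
Qed.

Lemma theta_part i X f : theta (spart i X) f = theta X (spart i f).
Proof. by rewrite (ident_even htheta). Qed.

Definition env_pr : pairing U G := Pairing theta_bilin theta_part.

Lemma env_separating : separating env_pr.
Proof.
move=> X hX; apply: (ident_inj htheta); apply: funext => f.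
by rewrite -[LHS]/(env_pr X f) hX -[RHS]/(env_pr 0 f) pr0l.
Qed.

Lemma env_hopf_dual : exists H, hopf_dual env_pr (OG_ops G) H.
Proof.
apply: hopf_dual_exists.
- by move=> X Y; exists (X * Y) => a; rewrite -conv_tpair -(ident_mul htheta).
- by exists 1 => a; rewrite /env_pr /pr (ident_one htheta).
- move=> X; apply: (dist_at_comul env_separating _ (theta_dist_at X)) => xi.
  by move=> /(ident_image htheta) [Y hY]; exists Y => f; rewrite -hY.
move=> X; have := dist_at_anti (theta_dist_at X); rewrite invg1.
by move=> /(ident_image htheta) [Y hY]; exists Y => f; rewrite /env_pr /pr hY.
Qed.

(** Elements of g are primitive because tangent vectors are derivations. *)
Lemma hopf_dual_is_enveloping_hopf H :
  hopf_dual env_pr (OG_ops G) H -> is_enveloping_hopf iota H.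
Proof.
move=> D; have inj := separating_inj env_separating; split.
- exact: hopf_dual_superalgebra env_separating (OG_hopf G) D.
- move=> X Y; apply: inj => f.
  by rewrite (dual_mul D) -conv_tpair /env_pr /pr (ident_mul htheta).
- by apply: inj => f; rewrite (dual_one D) /env_pr /pr (ident_one htheta).
move=> x; apply: (separating_inj (tpair_separating env_separating env_separating)).
apply: tpair_ext => a a'; rewrite (dual_comul D) prDl.
have one0 : homog false (1 : U) by exact: spart_one.
rewrite tpair_even_vr // tpair_even_vl // /env_pr /pr (ident_one htheta) (ident_iota htheta).
have /tangentP [_ ->] : is_tangent x by case: x => x /= /asboolP.
by [].
Qed.

End Enveloping.

Theorem proposition2p16 (k : fieldType) (hk : [pchar k] =i pred0)
    (G : supergroup k)
    (U : superAlg k) (iota : LieG G -> U)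
    (hU : is_enveloping (@lie k G) iota)
    (theta : U -> G -> k^o) (htheta : is_env_identification iota theta) :
  exists (HD : hopfOps (dist G)) (HG : hopfOps (grpalg G)) (HU : hopfOps U)
         (HT : hopfOps (tens (grpalg G) U))
         (Psi : dist G -> tens (grpalg G) U),
    [/\ is_dist_hopf HD, is_grpalg_hopf HG & is_enveloping_hopf iota HU] /\
    [/\ linear Psi, bijective Psi
      & forall (g : points G) (phi : dist G), dist_at g phi ->
          exists2 X : U, theta X = conv (pt_ev g^-1%g) phi
                       & Psi phi = grp_elt g ⊗ X] /\
    [/\ is_hopf_superalgebra HT, hopf_isomorphism HD HT Psi,
        forall x, hcomul HT x = tcomul (hcomul HG) (hcomul HU) x,
        forall x, hcounit HT x = tcounit (hcounit HG) (hcounit HU) x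
      & forall (g h : points G) (X Y : U),
          exists2 X' : U,
              theta X' = conv (conv (pt_ev h^-1%g) (theta X)) (pt_ev h)
            & hmul HT (grp_elt g ⊗ X) (grp_elt h ⊗ Y) =
                grp_elt (g * h)%g ⊗ (X' * Y)].
Proof.
pose b := env_pr htheta; have sepb : separating b := @env_separating _ _ _ _ _ htheta.
have im phi : dist_at 1%g phi <-> exists X, b X = phi := ident_image htheta phi.
have lb X : linear (b X : G -> k^o) := pr_linr b X.
have lp (x : points G) := pt_linear x.
have hG := OG_hopf G; have sepT := tens_separating sepb im.
have dconv (phi psi : G -> k^o) :
    dist_at 1%g phi -> dist_at 1%g psi -> dist_at 1%g (conv phi psi).
  move=> /im [X <-] /im [Y <-]; apply/im; exists (X * Y).
  by rewrite -(ident_mul htheta).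
have [HD DD] := dist_hopf_dual dconv.
have [HG DG] := grpalg_hopf_dual G.
have [HU DU] := env_hopf_dual htheta.
pose Psi phi := projT1 (cid (dist_tens im phi)).
have PsiE phi : tens_pr b (Psi phi) = phi :> (G -> k) by rewrite /Psi; case: cid.
pose Phi x := projT1 (cid (tens_dist im x)).
have PhiE x : tens_pr b x = Phi x :> (G -> k) by rewrite /Phi; case: cid.
have bij : bijective Psi.
  exists Phi => [phi|x]; first by apply: val_inj; rewrite /= -PhiE PsiE.
  by apply: (separating_inj sepT) => f; rewrite PsiE -PhiE.
have Psi_pr phi f : tens_pr b (Psi phi) f = dist_pr G phi f by rewrite PsiE.
(* The Hopf structure is transported from D(G) along Psi; the pairing then
   identifies its product and coproduct. *)
have [HT DT] : exists HT, hopf_dual (tens_pr b) (OG_ops G) HT.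
  apply: (hopf_dual_transport sepT DD Psi_pr) => x.
  by have [Phi' _ PsiK] := bij; exists (Phi' x).
exists HD, HG, HU, HT, Psi; split; [split|split; [split|split]].
- exact: hopf_dual_is_dist_hopf.
- exact: hopf_dual_is_grpalg_hopf.
- exact: hopf_dual_is_enveloping_hopf DU.
- exact: (adjoint_linear (f' := id) sepT Psi_pr).
- exact: bij.
- move=> g phi /(dist_tens_at im) [X [hX hgX]]; exists X => //.
  by apply: (separating_inj sepT) => f; rewrite PsiE hgX.
- exact: hopf_dual_superalgebra sepT hG DT.
- exact: hopf_dual_isomorphism sepT DD DT bij Psi_pr.
- exact: hopf_dual_tcomul (@grpalg_separating k G) sepb sepT DG DU DT.
- exact: hopf_dual_tcounit DG DU DT.
(* ev_g X ev_h Y = ev_(gh) (ev_(h^-1) X ev_h) Y *)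
move=> g h X Y.
have := dist_at_translater h (dist_at_translate h^-1%g (theta_dist_at htheta X)).
rewrite mulg1 mulVg => /im [X' hX']; exists X' => //.
apply: (separating_inj sepT) => f; rewrite (dual_mul DT) -conv_tpair !tens_prE.
have -> : b (X' * Y) = conv (b X') (b Y) :> (G -> k) by exact: ident_mul htheta X' Y.
rewrite hX' -[theta X]/(b X : G -> k^o); congr (_ f).
rewrite -conv_pt !convA //; try by do ?apply: conv_linear.
by rewrite -(convA (lp g) (lp h) (lp h^-1%g)) conv_pt mulgV conv_1r.
Qed.
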